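(* Let $d\ge 1$, $p\in(1,\infty)$, $s\in(0,1]$ and $f\in L^p_{\mathrm{loc}}(\mathbb{R}^d)$. Then $f\in N^{s,p}$ if and only if $\Phi^*_s f\in L^p(\mathbb{R}^d)$. Moreover, there are constants $0<c\le C<\infty$ depending only on $d,p$ such that $$c\,\|\Phi^*_s f\|_{L^p}\le [f]_{N^{s,p}}\le C\,\|\Phi^*_s f\|_{L^p}.$$
   Context: Functions $f$ are real-valued, measurable and everywhere defined on $\mathbb{R}^d$ (a representative is fixed). For $p\in[1,\infty)$ and $s\in(0,1]$, a function $f\in L^p_{\mathrm{loc}}(\mathbb{R}^d)$ belongs to $N^{s,p}$ if there is a measurable $g:\mathbb{R}^d\to[0,\infty]$ with $g\in L^p(\mathbb{R}^d)$ such that $$|f(x)-f(y)|\le |x-y|^s\big(\exp\{g(x)+g(y)\}-1\big)\qquad\text{for all }x\neq y\in\mathbb{R}^d$$ (with $\exp(\infty)=\infty$). $[f]_{N^{s,p}}$ is the infimum of $\|g\|_{L^p}$ over all such $g$ (and $+\infty$ if there is none). With $B_r(x)$ the open Euclidean ball of radius $r$ centered at $x$ and $|B_r(x)|$ its Lebesgue measure, $$\Phi^*_s f(x):=\sup_{r>0}\frac1{|B_r(x)|}\int_{B_r(x)}\log\Big(1+\frac{|f(x)-f(y)|}{r^s}\Big)\,dy .$$ *)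

(* Defs.v *)
From HB Require Import structures.
From mathcomp Require Import all_boot all_order all_algebra.
From mathcomp Require Import all_classical all_reals all_analysis measurable_realfun.

Set Implicit Arguments.
Unset Strict Implicit.
Unset Printing Implicit Defensive.
Import Order.TTheory GRing.Theory Num.Theory.
Import numFieldNormedType.Exports.

Local Open Scope classical_set_scope.
Local Open Scope ring_scope.

(* The canonical norm on 'rV[R]_d is the sup norm. *)
Definition euclid_norm (R : realType) (d : nat) (x : 'rV[R]_d) : R :=
  Num.sqrt (\sum_(i < d) x 0 i ^+ 2).

Definition euclid_ball (R : realType) (d : nat) (x : 'rV[R]_d) (r : R) :
  set 'rV[R]_d := [set y | euclid_norm (x - y) < r].

Section lebesgue_Rd.
Context (R : realType) (d : nat).
Local Open Scope ereal_scope.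

(* A box is given by its pair of extreme corners; it is empty, and has volume
   0, as soon as ab.2 0 i <= ab.1 0 i for some i. *)
Definition box (ab : 'rV[R]_d * 'rV[R]_d) : set 'rV[R]_d :=
  [set x | forall i, (ab.1 0 i < x 0 i <= ab.2 0 i)%R].

Definition box_volume (ab : 'rV[R]_d * 'rV[R]_d) : \bar R :=
  (\prod_(i < d) Num.max 0 (ab.2 0 i - ab.1 0 i))%R%:E.

(* The covers are the families (box (Q k))_(k in K) with K a set of natural
   numbers: allowing K to be finite or empty matters only when d = 0. *)
Definition lebesgue_outer (A : set 'rV[R]_d) : \bar R :=
  ereal_inf [set \esum_(k in KQ.1) box_volume (KQ.2 k) |
    KQ in [set KQ : set nat * (nat -> 'rV[R]_d * 'rV[R]_d) |
           A `<=` \bigcup_(k in KQ.1) box (KQ.2 k)]].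

Lemma box_volume_ge0 ab : 0 <= box_volume ab.
Proof. by rewrite lee_fin prodr_ge0// => i _; rewrite le_max lexx. Qed.

Lemma cover_volume_ge0 (KQ : set nat * (nat -> 'rV[R]_d * 'rV[R]_d)) :
  0 <= \esum_(k in KQ.1) box_volume (KQ.2 k).
Proof. by apply: esum_ge0 => k _; exact: box_volume_ge0. Qed.

Lemma lebesgue_outer_ge0 A : 0 <= lebesgue_outer A.
Proof.
by apply: le_ereal_inf_tmp => _ [KQ _ <-]; exact: cover_volume_ge0.
Qed.

Lemma lebesgue_outer0 : lebesgue_outer set0 = 0.
Proof.
apply/eqP; rewrite eq_le lebesgue_outer_ge0 andbT.
by apply: ereal_inf_lbound; exists (set0, fun=> (0%R, 0%R)) => //=;
  exact: esum_set0.
Qed.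

Lemma le_lebesgue_outer : {homo lebesgue_outer : A B / A `<=` B >-> A <= B}.
Proof.
move=> A B AB; apply/ereal_inf_le_tmp => _ [KQ BKQ <-].
by exists KQ => //; exact: subset_trans BKQ.
Qed.

Lemma lebesgue_outer_sigma_subadditive : sigma_subadditive lebesgue_outer.
Proof.
have outer_ge0 := lebesgue_outer_ge0.
move=> A; have [[i ioo]|] := pselect (exists i, lebesgue_outer (A i) = +oo).
  by rewrite (eseries_pinfty _ _ ioo) ?leey// => n _;
    rewrite -ltNye (lt_le_trans _ (lebesgue_outer_ge0 _)).
rewrite -forallNE => Aoo; apply/lee_addgt0Pr => e e0.
apply: (le_trans _ (epsilon_trick _ _ (ltW e0))) => //.
have [G PG] : {G : nat -> set nat * (nat -> 'rV[R]_d * 'rV[R]_d) & forall n,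
    A n `<=` \bigcup_(k in (G n).1) box ((G n).2 k) /\
    \esum_(k in (G n).1) box_volume ((G n).2 k) <=
      lebesgue_outer (A n) + (e / (2 ^ n.+1)%:R)%:E}.
  apply: (@choice _ _ (fun n KQ =>
    A n `<=` \bigcup_(k in KQ.1) box (KQ.2 k) /\
    \esum_(k in KQ.1) box_volume (KQ.2 k) <=
      lebesgue_outer (A n) + (e / (2 ^ n.+1)%:R)%:E)) => n.
  have en : (0 < e / (2 ^ n.+1)%:R)%R by rewrite divr_gt0// ltr0n expn_gt0.
  have Afin : lebesgue_outer (A n) \is a fin_num.
    by rewrite ge0_fin_numE// ltey; apply/eqP/Aoo.
  have [_ [KQ AKQ <-] /ltW KQe] := lb_ereal_inf_adherent en Afin.
  by exists KQ.
have /card_esym/ppcard_eqP[f] := card_nat2.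
pose g : nat -> nat * nat := f.
have gbij : set_bij [set k | (G (g k).1).1 (g k).2]
    ([set: nat] `*`` fun n => (G n).1) g.
  split.
  - by move=> k /= Gk; split.
  - by move=> x y _ _; apply: inj; rewrite inE.
  - move=> [n m] /= [_ Gnm]; exists (f^-1%FUN (n, m)).
      by rewrite /g/= invK ?inE.
    by rewrite /g invK ?inE.
apply: (@le_trans _ _ (\esum_(n in [set: nat]) \esum_(m in (G n).1)
    box_volume ((G n).2 m))).
  rewrite esum_esum => [|n m _ _]; last exact: box_volume_ge0.
  rewrite (reindex_esum _ _ _ _ gbij); apply: ereal_inf_lbound.
  exists ([set k | (G (g k).1).1 (g k).2], fun k => (G (g k).1).2 (g k).2) => //.
  move=> x [n _ /(PG n).1[m Gnm Qx]]; exists (f^-1%FUN (n, m)) => /=;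
    by rewrite /g invK ?inE.
rewrite -nneseries_esumT => [|n]; last exact: cover_volume_ge0.
by apply: lee_nneseries => [n _ _|n _]; [exact: cover_volume_ge0|exact: (PG n).2].
Qed.

HB.instance Definition _ := isOuterMeasure.Build R 'rV[R]_d lebesgue_outer
  lebesgue_outer0 lebesgue_outer_ge0 le_lebesgue_outer
  lebesgue_outer_sigma_subadditive.

(* R^d with its Lebesgue-measurable sets (a complete sigma-algebra). *)
Definition Rd := caratheodory_type lebesgue_outer.

HB.instance Definition _ := Measurable.on Rd.

Definition lebesgue : set Rd -> \bar R := lebesgue_outer.

HB.instance Definition _ := isMeasure.Build _ Rd R lebesgue
  (@caratheodory_measure0 R _ lebesgue_outer)
  (@caratheodory_measure_ge0 R _ lebesgue_outer)
  (@caratheodory_measure_sigma_additive R _ lebesgue_outer).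

Definition in_Lp (p : R) (h : 'rV[R]_d -> \bar R) : Prop :=
  measurable_fun [set: Rd] (h : Rd -> \bar R) /\ 'N[lebesgue]_p%:E[h] < +oo.

Definition in_Lp_loc (p : R) (f : 'rV[R]_d -> R) : Prop :=
  measurable_fun [set: Rd] (f : Rd -> R) /\
  forall K : set 'rV[R]_d, compact K ->
    \int[lebesgue]_(x in K) (`|f x| `^ p)%:E < +oo.

Definition admissible (s p : R) (f : 'rV[R]_d -> R)
    (g : 'rV[R]_d -> \bar R) : Prop :=
  [/\ forall x, 0 <= g x, in_Lp p g &
      forall x y : 'rV[R]_d, x != y ->
        (`|f x - f y|)%:E <=
        (euclid_norm (x - y) `^ s)%:E * (expeR (g x + g y) - 1)].

Definition in_N (s p : R) (f : 'rV[R]_d -> R) : Prop :=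
  in_Lp_loc p f /\ exists g, admissible s p f g.

Definition N_seminorm (s p : R) (f : 'rV[R]_d -> R) : \bar R :=
  ereal_inf [set 'N[lebesgue]_p%:E[g] | g in admissible s p f].

Definition log_maximal (s : R) (f : 'rV[R]_d -> R) (x : 'rV[R]_d) : \bar R :=
  ereal_sup [set (lebesgue (euclid_ball x r))^-1 *
      \int[lebesgue]_(y in euclid_ball x r)
        (ln (1 + `|f x - f y| / (r `^ s)))%:E | r in [set r : R | (0 < r)%R]].

End lebesgue_Rd.

(* Main.v *)
Require Import Defs.
From HB Require Import structures.
From mathcomp Require Import all_boot all_order all_algebra.
From mathcomp Require Import all_classical all_reals all_analysis
  measurable_realfun.
From mathcomp Require Import lra ring.

(* If [g] is admissible then log(1 + |f x - f y| / r^s) <= g x + g y for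
   |x - y| < r, so the log-maximal function is at most [g] plus the
   Hardy-Littlewood maximal function of [g]. The L^p bound of the latter comes
   from the weak type (1,1) inequality (finite Vitali covering over a countable
   family of rational balls) summed over dyadic levels.
   Conversely, for x <> y and r = |x - y|, log is subadditive in the sense that
   log(1 + |f x - f y| / r^s) <=
     log(1 + |f x - f z| / r^s) + log(1 + |f y - f z| / r^s);
   averaging over z in the ball of radius r / 2 about the midpoint shows that
   2^d times the log-maximal function is admissible, with no recourse to a
   differentiation theorem.
   The Lebesgue measure being given by its outer measure, the only facts on
   volumes that are needed are 0 < |B_1| < oo and |B_r(x)| = r^d |B_1|. *)

Set Implicit Arguments.
Unset Strict Implicit.
Unset Printing Implicit Defensive.
Import Order.TTheory GRing.Theory Num.Theory.
Import numFieldNormedType.Exports.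

Local Open Scope classical_set_scope.
Local Open Scope ring_scope.

(** * Euclidean norm and balls on row vectors *)

Section euclidean_norm.
Context (R : realType) (d : nat).
Implicit Types (x y : 'rV[R]_d).

Lemma euclid_norm_ge0 x : 0 <= euclid_norm x.
Proof. exact: sqrtr_ge0. Qed.

Lemma sqr_euclid_norm x : euclid_norm x ^+ 2 = \sum_(i < d) x 0 i ^+ 2.
Proof. by rewrite sqr_sqrtr// sumr_ge0// => i _; exact: sqr_ge0. Qed.

Lemma euclid_norm0 : euclid_norm (0 : 'rV[R]_d) = 0.
Proof.
by rewrite /euclid_norm big1 ?sqrtr0// => i _; rewrite mxE expr0n.
Qed.

Lemma euclid_norm_eq0 x : (euclid_norm x == 0) = (x == 0).
Proof.
apply/eqP/eqP => [x0|->]; last exact: euclid_norm0.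
apply/rowP => i; rewrite mxE; apply/eqP; rewrite -sqrf_eq0.
have := sqr_euclid_norm x; rewrite x0 expr0n/= => /esym/eqP.
by rewrite psumr_eq0 => [/allP/(_ i)|j _]; [apply;
  rewrite mem_index_enum|exact: sqr_ge0].
Qed.

Lemma euclid_normZ (a : R) x : euclid_norm (a *: x) = `|a| * euclid_norm x.
Proof.
rewrite /euclid_norm -sqrtr_sqr -sqrtrM ?sqr_ge0// mulr_sumr.
by congr Num.sqrt; apply: eq_bigr => i _; rewrite mxE exprMn.
Qed.

Lemma euclid_normN x : euclid_norm (- x) = euclid_norm x.
Proof. by rewrite -scaleN1r euclid_normZ normrN1 mul1r. Qed.

Lemma euclid_distC x y : euclid_norm (x - y) = euclid_norm (y - x).
Proof. by rewrite -euclid_normN opprB. Qed.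

(** Cauchy-Schwarz: with [a] and [b] the two norms, the sum of the squares of
    [b * x 0 i - a * y 0 i] is nonnegative and equals 2ab times the gap between the two sides. *)
Lemma euclid_inner_le x y :
  \sum_(i < d) x 0 i * y 0 i <= euclid_norm x * euclid_norm y.
Proof.
set a := euclid_norm x; set b := euclid_norm y.
have [/eqP|a0] := eqVneq a 0.
  by rewrite euclid_norm_eq0 => /eqP x0;
    rewrite big1 ?mulr_ge0 ?euclid_norm_ge0// => i _; rewrite x0 mxE mul0r.
have [/eqP|b0] := eqVneq b 0.
  by rewrite euclid_norm_eq0 => /eqP x0;
    rewrite big1 ?mulr_ge0 ?euclid_norm_ge0// => i _; rewrite x0 mxE mulr0.
have ab0 : 0 < a * b by rewrite mulr_gt0// lt0r ?a0 ?b0 euclid_norm_ge0.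
have : 0 <= \sum_(i < d) (b * x 0 i - a * y 0 i) ^+ 2.
  by apply: sumr_ge0 => i _; exact: sqr_ge0.
rewrite [leRHS](_ : _ = 2 * (a * b) * (a * b - \sum_(i < d) x 0 i * y 0 i)).
  by rewrite pmulr_rge0 ?subr_ge0// mulr_gt0.
under eq_bigr do rewrite sqrrB !exprMn.
rewrite big_split/= sumrB -!mulr_sumr -!sqr_euclid_norm -/a -/b.
rewrite (eq_bigr (fun i => (2 * (a * b)) * (x 0 i * y 0 i))) => [|i _];
  last by rewrite -mulr_natr; ring.
rewrite -mulr_sumr; ring.
Qed.

Lemma euclid_normD x y : euclid_norm (x + y) <= euclid_norm x + euclid_norm y.
Proof.
rewrite -(@ler_pXn2r _ 2)// ?nnegrE ?addr_ge0 ?euclid_norm_ge0//.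
rewrite sqr_euclid_norm sqrrD !sqr_euclid_norm.
under eq_bigr do rewrite mxE sqrrD.
rewrite 2!big_split/= lerD2r lerD2l sumrMnl lerMn2r/=.
exact: euclid_inner_le.
Qed.

Lemma euclid_distD (z x y : 'rV[R]_d) :
  euclid_norm (x - y) <= euclid_norm (x - z) + euclid_norm (z - y).
Proof. by rewrite (le_trans _ (euclid_normD _ _))// addrA subrK. Qed.

Lemma coord_le_euclid_norm x i : `|x 0 i| <= euclid_norm x.
Proof.
rewrite -(@ler_pXn2r _ 2)// ?nnegrE ?euclid_norm_ge0//.
rewrite sqr_euclid_norm real_normK ?num_real// (bigD1 i)//= lerDl.
by apply: sumr_ge0 => j _; exact: sqr_ge0.
Qed.

Lemma euclid_norm_le_coord x (e : R) : 0 <= e -> (forall i, `|x 0 i| <= e) ->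
  euclid_norm x <= d%:R * e.
Proof.
move=> e0 xe; rewrite -(@ler_pXn2r _ 2)// ?nnegrE ?mulr_ge0 ?euclid_norm_ge0//.
rewrite sqr_euclid_norm (@le_trans _ _ (\sum_(i < d) e ^+ 2))//.
  apply: ler_sum => i _; rewrite -real_normK ?num_real//.
  by rewrite ler_pXn2r ?nnegrE.
rewrite sumr_const card_ord -[leLHS]mulr_natl exprMn ler_wpM2r ?sqr_ge0//.
by rewrite -natrX ler_nat; case: (d) => // n;
  rewrite expnS leq_pmulr// expn_gt0.
Qed.

Lemma euclid_ballxx x (r : R) : 0 < r -> euclid_ball x r x.
Proof. by move=> r0; rewrite /euclid_ball/= subrr euclid_norm0. Qed.

Lemma euclid_ball_sub x y (r t : R) : euclid_norm (x - y) + r <= t ->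
  euclid_ball y r `<=` euclid_ball x t.
Proof.
move=> xyr z yz; apply: le_lt_trans (euclid_distD y _ _) _.
by apply: lt_le_trans xyr; rewrite ltrD2l.
Qed.

End euclidean_norm.

(** * Carathéodory measurability of half-spaces, boxes and Euclidean open sets *)

Section measurable_boxes.
Context (R : realType) (d : nat).
Implicit Types (x y : 'rV[R]_d).

(** Truncating one coordinate of a corner at [c] gives two boxes again, because sides are open on
    the left and closed on the right. The volumes still add up when one piece is empty, thanks to
    the [Num.max 0] in each length. *)
Lemma box_volume_split (ab : 'rV[R]_d * 'rV[R]_d) (i : 'I_d) (c : R) :
  exists Q1 Q2, [/\ box ab `&` [set x | x 0 i <= c] `<=` box Q1,
     box ab `&` [set x | c < x 0 i] `<=` box Q2 &
     (box_volume Q1 + box_volume Q2 = box_volume ab)%E].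
Proof.
case: ab => a b.
pose b' := \row_j (if j == i then Num.min (b 0 j) c else b 0 j).
pose a' := \row_j (if j == i then Num.max (a 0 j) c else a 0 j).
exists (a, b'), (a', b); split.
- move=> x [/= abx xc] j /=; have := abx j; rewrite mxE.
  by case: eqP => [->/andP[-> /=]|//]; rewrite le_min xc => ->.
- move=> x [/= abx xc] j /=; have := abx j; rewrite mxE.
  by case: eqP => [->/andP[ax /= ->]|//]; rewrite gt_max ax xc.
rewrite /box_volume/= -EFinD; congr EFin.
rewrite (bigD1 i)//= [X in _ + X](bigD1 i)//= [RHS](bigD1 i)//= !mxE eqxx.
rewrite [X in _ * X + _](eq_bigr (fun j => Num.max 0 (b 0 j - a 0 j)));
  last first.
  by move=> j /negPf ji; rewrite mxE ji.
rewrite [X in _ + _ * X](eq_bigr (fun j => Num.max 0 (b 0 j - a 0 j)));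
  last first.
  by move=> j /negPf ji; rewrite mxE ji.
rewrite -mulrDl; congr (_ * _).
by rewrite !(minEle, maxEle); case: (lerP (b 0 i) c) => ?;
  case: (lerP (a 0 i) c) => ?;
  do ![case: lerP => ?]; lra.
Qed.

(** Every box of a cover is cut along the hyperplane; the two families of pieces cover the two parts
    of the test set, and their total volume is that of the original cover. *)
Lemma measurable_halfspace (i : 'I_d) (c : R) :
  measurable ([set x : Rd R d | (x : 'rV[R]_d) 0 i <= c]).
Proof.
apply: le_caratheodory_measurable => X; rewrite -/(lebesgue_outer X).
apply: le_ereal_inf_tmp => _ [[K Q] /= XKQ <-].
pose Q12 k := cid (box_volume_split (Q k) i c).
pose Q1 k := projT1 (Q12 k).
pose Q2' k := cid (projT2 (Q12 k)).
pose Q2 k := projT1 (Q2' k).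
have P1 k : box (Q k) `&` [set x | x 0 i <= c] `<=` box (Q1 k).
  by rewrite /Q1; case: (projT2 (Q2' k)).
have P2 k : box (Q k) `&` [set x | c < x 0 i] `<=` box (Q2 k).
  by rewrite /Q2; case: (projT2 (Q2' k)).
have P3 k : (box_volume (Q k) = box_volume (Q1 k) + box_volume (Q2 k))%E.
  by rewrite /Q1 /Q2; case: (projT2 (Q2' k)).
rewrite (eq_esum (fun k _ => P3 k)) esumD; [|by move=> k _;
  exact: box_volume_ge0..].
apply: leeD; apply: ereal_inf_lbound.
  exists (K, Q1) => //= x [/XKQ[k Kk kx] xc]; exists k => //=; exact: P1.
exists (K, Q2) => //= x [/XKQ[k Kk kx] /negP]; rewrite -ltNge => xc.
by exists k => //=; exact: P2.
Qed.

Lemma measurable_box (ab : 'rV[R]_d * 'rV[R]_d) : measurable (box ab : set (Rd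
  R d)).
Proof.
rewrite (_ : box ab = \bigcap_(i in [set: 'I_d])
   ([set x : Rd R d | (x : 'rV[R]_d) 0 i <= ab.2 0 i] `&` ~` [set x : Rd R d |
     (x : 'rV[R]_d) 0 i <= ab.1 0 i])).
  apply: fin_bigcap_measurable => // i _; apply: measurableI;
    first exact: measurable_halfspace.
  by apply: measurableC; exact: measurable_halfspace.
apply/seteqP; split => x /= abx i => [_|].
  by case/andP: (abx i) => h1 h2; split => //=; apply/negP; rewrite -ltNge.
by have [/= -> /negP] := abx i Logic.I; rewrite -ltNge => ->.
Qed.

Lemma exists_rat_vector x (e : R) : 0 < e ->
  exists q : 'rV[rat]_d, forall i, `|x 0 i - ratr (q 0 i)| < e.
Proof.
move=> e0.
have Q i : exists q : rat, `|x 0 i - ratr q| < e.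
  have /rat_in_itvoo[q] : x 0 i - e < x 0 i + e by rewrite ltrD2l gtrN.
  by rewrite in_itv/= => h; exists q; rewrite distrC ltr_distl.
exists (\row_i projT1 (cid (Q i))) => i; rewrite mxE.
exact: projT2 (cid (Q i)).
Qed.

Definition rat_box (qn : 'rV[rat]_d * nat) : set (Rd R d) :=
  box (\row_i (ratr (qn.1 0 i) - qn.2.+1%:R^-1), \row_i (ratr (qn.1 0 i) +
    qn.2.+1%:R^-1)).

(** [U] is the union of the boxes [rat_box] that it contains, a countable family. *)
Lemma measurable_euclid_open (U : set 'rV[R]_d) :
  (forall x, U x -> exists2 e : R, 0 < e & euclid_ball x e `<=` U) ->
  measurable (U : set (Rd R d)).
Proof.
move=> oU.
rewrite (_ : U = \bigcup_(qn in [set qn | rat_box qn `<=` U]) rat_box qn).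
  rewrite bigcup_mkcond.
  apply: countable_bigcupT_measurable; first exact: countableP.
  by move=> qn; case: ifPn => // _; exact: measurable_box.
apply/seteqP; split => [x Ux|x [qn /= sub /sub]//].
have [e e0 xeU] := oU _ Ux.
(* Two points of a box of side 2/(n+1) are at distance at most 2d/(n+1), which must be less than
   [e]. Using [d.+1] keeps the divisor positive in dimension 0. *)
have e20 : 0 < e / (2 * d.+1%:R) by rewrite divr_gt0 ?mulr_gt0.
have [n ne] : exists n : nat, n.+1%:R^-1 < e / (2 * d.+1%:R).
  by have [n _ /(_ n (leqnn n))] := near_infty_natSinv_lt (PosNum e20);
    exists n.
have n0 : 0 < n.+1%:R^-1 :> R by [].
have [q xq] := exists_rat_vector x n0.
exists (q, n) => /=; last first.
  move=> i /=; rewrite !mxE; have := xq i; rewrite ltr_distl => /andP[h1 h2].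
  by rewrite h1 ltW.
apply: subset_trans xeU => y /= yq.
rewrite /euclid_ball/=; apply: (@le_lt_trans _ _ (d%:R * (2 * n.+1%:R^-1))).
  apply: euclid_norm_le_coord => [|i]; first by rewrite mulr_ge0.
  rewrite !mxE; have := yq i; rewrite /= !mxE => /andP[h1 h2].
  have := xq i; rewrite ltr_distl => /andP[h3 h4].
  rewrite ler_distl; move: (n.+1%:R^-1) h1 h2 h3 h4 => w; move: (ratr _) =>
    z h1 h2 h3 h4.
  by apply/andP; split; lra.
apply: (@le_lt_trans _ _ (d.+1%:R * (2 * n.+1%:R^-1))).
  by rewrite ler_wpM2r ?mulr_ge0// ler_nat.
by rewrite mulrA -ltr_pdivlMl ?mulr_gt0// mulrC (mulrC d.+1%:R).
Qed.

Lemma measurable_euclid_ball x (r : R) : measurable (euclid_ball x r : set (Rd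
  R d)).
Proof.
apply: measurable_euclid_open => y xy; exists (r - euclid_norm (x - y)).
  by rewrite subr_gt0.
by apply: euclid_ball_sub; rewrite addrC subrK.
Qed.

End measurable_boxes.

(** * Volumes of balls from the outer measure *)

Section lebesgue_volume.
Context (R : realType) (d : nat).
Notation mu := (@lebesgue R d).
Implicit Types (x y : 'rV[R]_d).
Local Open Scope ereal_scope.

Let weighted_volume_ge0 (b : bool) (ab : 'rV[R]_d * 'rV[R]_d) :
  0 <= b%:R%:E * box_volume ab.
Proof. by apply: mule_ge0; [rewrite lee_fin ler0n|exact: box_volume_ge0]. Qed.

(** Weights 0 and 1 turn the sum over an index set into a series over all naturals, where scaling
    and Tonelli apply. *)
Lemma cover_volume_series (KQ : set nat * (nat -> 'rV[R]_d * 'rV[R]_d)) :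
  \esum_(k in KQ.1) box_volume (KQ.2 k) =
  \sum_(0 <= k <oo) ((k \in KQ.1)%:R%:E * box_volume (KQ.2 k)).
Proof.
rewrite nneseries_esumT => [|k]; last exact: weighted_volume_ge0.
rewrite esum_mkcond; apply: eq_esum => k _.
by case: ifPn => kK; rewrite ?mul1e ?mul0e.
Qed.

(** The map sends boxes to boxes and multiplies each volume by [t ^+ d], so covers of [A] become
    covers of the image. The reverse inequality follows by applying this one to the inverse map. *)
Lemma lebesgue_outer_affine_le (a : 'rV[R]_d) (t : R) (A : set 'rV[R]_d) : (0 <
  t)%R ->
  lebesgue_outer [set (a + t *: x)%R | x in A] <= (t ^+ d)%:E * lebesgue_outer
    A.
Proof.
move=> t0; have td : (0 < t ^+ d)%R by rewrite exprn_gt0.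
rewrite -lee_pdivrMl//; apply: le_ereal_inf_tmp => _ [[K Q] /= AKQ <-].
rewrite lee_pdivrMl//.
pose Q' k := ((a + t *: (Q k).1)%R, (a + t *: (Q k).2)%R).
have Q'E k : box_volume (Q' k) = (t ^+ d)%:E * box_volume (Q k).
  rewrite /box_volume/= -EFinM; congr EFin.
  rewrite -[in X in (X * _)%R](card_ord d) -prodr_const -big_split/=.
  apply: eq_bigr => i _; rewrite !mxE maxr_pMr ?ltW// mulr0.
  by congr Num.max; rewrite mulrBr opprD addrACA subrr add0r.
apply: (@le_trans _ _ (\esum_(k in K) box_volume (Q' k))).
  apply: ereal_inf_lbound; exists (K, Q') => //= _ [x /AKQ[k Kk Qx] <-].
  exists k => //= i; rewrite /= !mxE; have := Qx i => /andP[h1 h2].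
  by rewrite ltrD2l lerD2l ltr_pM2l// ler_pM2l// h1 h2.
rewrite (cover_volume_series (K, Q')) (cover_volume_series (K, Q))/=.
rewrite -nneseriesZl => [|k _]; last exact: weighted_volume_ge0.
apply: lee_nneseries => [k _ _|k _]; first exact: weighted_volume_ge0.
by rewrite Q'E muleCA.
Qed.

Definition unit_cube : set 'rV[R]_d := [set x | forall i, (0 <= x 0 i <= 1)%R].

(* The inequality 1 <= sum_k 1_(Q_k), valid on the unit cube, is integrated one
   coordinate at a time, which replaces indicators by lengths; [j] coordinates
   remain to be integrated. *)
Let partial_volume (Q : nat -> 'rV[R]_d * 'rV[R]_d) (j : nat) (x : 'rV[R]_d) (k
  : nat) : R :=
  (\prod_(i < d) if (i < j)%N then \1_(`](Q k).1 0%R i, (Q k).2 0%R i]%classic)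
    (x 0 i)
     else Num.max 0 ((Q k).2 0 i - (Q k).1 0 i))%R.

Lemma lebesgue_outer_unit_cube : 1 <= lebesgue_outer unit_cube.
Proof.
apply: le_ereal_inf_tmp => _ [[K Q] /= cov <-].
rewrite (cover_volume_series (K, Q))/=.
suff P j : (j <= d)%N -> forall x, unit_cube x ->
    1 <= \sum_(0 <= k <oo) ((k \in K)%:R * partial_volume Q j x k)%:E.
  apply: le_trans (P 0%N (leq0n _) 0%R _) _; first by move=> i;
    rewrite mxE lexx ler01.
  by under [leRHS]eq_eseriesr do rewrite -EFinM.
(* Induction on the number [d - j] of coordinates already integrated. *)
move=> jd; rewrite -(subKn jd); move: (d - j)%N (leq_subr j d) => {j jd}.
have len0 (a b : R) : (0 <= Num.max 0 (b - a))%R by rewrite le_max lexx.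
have pv0 j' x k : (0 <= partial_volume Q j' x k)%R.
  by apply: prodr_ge0 => i _; case: ifP.
elim => [_ x xcube|m IH md x xcube].
  (* With no coordinate integrated, a box containing [x] contributes a term equal to 1. *)
  rewrite subn0; have [k Kk xk] := cov _ xcube.
  apply: le_trans (nneseries_lim_ge k.+1 _) => [|n _ _]; last first.
    by rewrite lee_fin mulr_ge0.
  rewrite big_nat_recr//= -[leLHS]add0e leeD//.
    by apply: sume_ge0 => i _; rewrite lee_fin mulr_ge0.
  rewrite mem_set// mul1r lee_fin /partial_volume big1// => i _.
  by rewrite ltn_ord indicE mem_set//= in_itv/=; exact: xk.
pose j := (d - m.+1)%N.
have jd : (j < d)%N by rewrite /j subnSK// leq_subr.
have jE : (d - m = j.+1)%N by rewrite /j subnSK.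
pose j0 := Ordinal jd.
(* Only the coordinate [j0] passes from indicator to length: [upd t] makes it the integration
   variable, and [c k] gathers the factors that do not depend on it. *)
pose upd (t : R) : 'rV[R]_d := (\row_i if i == j0 then t else x 0 i)%R.
pose I k : set R := `](Q k).1 0%R j0, (Q k).2 0%R j0]%classic.
pose c k : R := ((k \in K)%:R * \prod_(i < d | i != j0)
   if (i < j)%N then \1_(`](Q k).1 0%R i, (Q k).2 0%R i]%classic) (x 0%R i)
     else Num.max 0 ((Q k).2 0 i - (Q k).1 0 i))%R.
have c0 k : (0 <= c k)%R by rewrite /c mulr_ge0// prodr_ge0// => i _; case: ifP.
have E1 t k : ((k \in K)%:R * partial_volume Q (d - m) (upd t) k = c k * \1_(I
  k) t)%R.
  rewrite /partial_volume (bigD1 j0)//= jE ltnSn mxE eqxx mulrA mulrAC.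
  congr (_ * _ * _)%R; apply: eq_bigr => i ij0; rewrite mxE (negPf ij0).
  by rewrite ltnS leq_eqVlt -[_ == j :> nat]/(i == j0) (negPf ij0).
have E2 k : ((k \in K)%:R * partial_volume Q (d - m.+1) x k =
    c k * Num.max 0 ((Q k).2 0 j0 - (Q k).1 0 j0))%R.
  by rewrite /partial_volume (bigD1 j0)//= ltnn mulrA mulrAC.
pose J : set R := `[0%R, 1%R]%classic.
have mJ : measurable J by exact: measurable_itv.
have lJ : lebesgue_measure J = 1.
  by rewrite lebesgue_measure_itv/= lte_fin ltr01 oppr0 adde0.
have int1 : \int[lebesgue_measure]_(t in J) (cst 1%E t) = 1 :> \bar R.
  by rewrite integral_cst// [X in _ * X]lJ mul1e.
have mIk k : measurable (I k) by exact: measurable_itv.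
have mI k : measurable_fun J (fun t => (c k * \1_(I k) t)%:E).
  by apply/measurable_EFinP; apply: measurable_funM.
rewrite -[leLHS]int1.
under eq_eseriesr do rewrite E2.
(* The induction hypothesis at [upd t] is integrated over [t] in [0, 1]; Tonelli then replaces each
   indicator by the length of its interval inside [0, 1], at most the full length. *)
apply: (@le_trans _ _ (\int[lebesgue_measure]_(t in J)
    (\sum_(0 <= k <oo) (c k * \1_(I k) t)%:E))).
  apply: ge0_le_integral => //.
  - apply: (@ge0_emeasurable_sum _ _ _ _ (fun k t =>
    (c k * \1_(I k) t)%:E) xpredT) => [k t _ _|k _].
      by rewrite lee_fin mulr_ge0.
    exact: mI.
  - move=> t; rewrite /J/= in_itv/= => t01.
    under eq_eseriesr do rewrite -E1.
    apply: (IH (ltnW md)) => i; rewrite mxE.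
    by case: eqP.
rewrite integral_nneseries//; last by move=> k t _; rewrite lee_fin mulr_ge0.
apply: lee_nneseries => [k _ _|k _]; first by apply: integral_ge0 => t _;
  rewrite lee_fin mulr_ge0.
under eq_integral do rewrite EFinM.
have mIE k' : measurable_fun J (fun t =>
  (\1_(I k') t : R)%:E) by exact/measurable_EFinP.
rewrite ge0_integralZl_EFin//; last exact: mIE.
rewrite integral_indic; [|exact: mJ|exact: mIk].
rewrite [leRHS]EFinM; apply: lee_wpmul2l; first by rewrite lee_fin.
apply: (@le_trans _ _ (lebesgue_measure (I k))).
  apply: le_measure; rewrite ?inE; [|exact: mIk|exact: subIsetl].
  by apply: measurableI; [exact: mIk|exact: mJ].
rewrite [leLHS]lebesgue_measure_itv/= lte_fin; case: ifPn => h;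
  last by rewrite lee_fin.
by rewrite -EFinD lee_fin le_max lexx orbT.
Qed.

(** Nothing is lost by [fine]: the unit ball fits in a box of side 2, so its outer measure is
    finite. *)
Definition unit_ball_volume : R := fine (lebesgue_outer (euclid_ball (0%R :
  'rV[R]_d) 1)).

Let ball1_fin : lebesgue_outer (euclid_ball (0%R : 'rV[R]_d) 1) < +oo.
Proof.
pose Q : 'rV[R]_d * 'rV[R]_d := (const_mx (-1)%R, const_mx 1%R).
apply: (@le_lt_trans _ _ (box_volume Q)); last by rewrite ltry.
apply: (@le_trans _ _ (\esum_(k in [set 0%N]) box_volume Q)); last first.
  by rewrite esum_set1// box_volume_ge0.
apply: ereal_inf_lbound; exists ([set 0%N], fun=> Q) => //= x.
rewrite /euclid_ball/= sub0r euclid_normN => x1; exists 0%N => //= i;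
  rewrite /= !mxE.
have := le_lt_trans (coord_le_euclid_norm x i) x1.
by rewrite ltr_norml => /andP[-> /ltW].
Qed.

Lemma euclid_ball_affine (a : 'rV[R]_d) x (t r : R) : (0 < t)%R ->
  [set (a + t *: y)%R | y in euclid_ball x r] = euclid_ball (a + t *: x)%R (t *
    r)%R.
Proof.
move=> t0; apply/seteqP; split => [_ [y xy <-]|z xz].
  rewrite /euclid_ball/= opprD addrACA subrr add0r -scalerBr euclid_normZ.
  by rewrite gtr0_norm// ltr_pM2l.
exists (t^-1 *: (z - a))%R; last by rewrite scalerA divff ?gt_eqF// scale1r
  addrC subrK.
rewrite /euclid_ball/= -(ltr_pM2l t0) -[X in (X * euclid_norm _)%R]gtr0_norm//.
rewrite -euclid_normZ scalerBr scalerA divff ?gt_eqF// scale1r.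
by rewrite opprB addrA [(_ + a)%R]addrC.
Qed.

(** The affine inequality is used twice: for the map carrying the unit ball onto this one, and for
    its inverse. *)
Lemma lebesgue_ball x (r : R) : (0 < r)%R ->
  mu (euclid_ball x r) = (r ^+ d * unit_ball_volume)%:E.
Proof.
move=> r0; rewrite /mu/= /lebesgue EFinM fineK ?ge0_fin_numE
  ?lebesgue_outer_ge0//.
apply/eqP; rewrite eq_le; apply/andP; split.
  have := lebesgue_outer_affine_le x (euclid_ball 0%R 1) r0.
  by rewrite euclid_ball_affine// scaler0 addr0 mulr1.
rewrite -lee_pdivlMl ?exprn_gt0// -exprVn.
have ri0 : (0 < r^-1)%R by rewrite invr_gt0.
have := lebesgue_outer_affine_le (- (r^-1 *: x))%R (euclid_ball x r) ri0.
by rewrite euclid_ball_affine// addrC subrr mulVf ?gt_eqF.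
Qed.

(** The unit cube, of outer measure at least 1, lies in the ball of radius [d.+1], whose volume is a
    multiple of that of the unit ball. *)
Lemma unit_ball_volume_gt0 : (0 < unit_ball_volume)%R.
Proof.
have sub : unit_cube `<=` euclid_ball (0%R : 'rV[R]_d) (d.+1%:R)%R.
  move=> x xc; rewrite /euclid_ball/= sub0r euclid_normN.
  apply: (@le_lt_trans _ _ (d%:R * 1)%R); last by rewrite mulr1 ltr_nat.
  by apply: euclid_norm_le_coord => // i; have /andP[h0 h1] := xc i;
    rewrite ger0_norm.
have : 1 <= mu (euclid_ball (0%R : 'rV[R]_d) (d.+1%:R)%R).
  by apply: le_trans lebesgue_outer_unit_cube _; exact: le_lebesgue_outer.
rewrite lebesgue_ball// lee_fin => h.
have : (0 < d.+1%:R ^+ d * unit_ball_volume)%R by exact: lt_le_trans h.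
by rewrite pmulr_rgt0// exprn_gt0.
Qed.

End lebesgue_volume.

(** * Finite Vitali covering and the weak type (1,1) inequality *)

Section weak_type_inequality.
Context (R : realType) (d : nat).
Notation mu := (@lebesgue R d).
Implicit Types (x : 'rV[R]_d) (b : 'rV[R]_d * R) (h : Rd R d -> \bar R).

(** Induction on the list sorted by increasing radius, so that the head is the smallest ball. Either
    it meets a ball selected from the tail, and lies in its triple, or it joins the selection. *)
Lemma vitali_euclid_ball (s : seq ('rV[R]_d * R)) : (forall b, b \in s -> 0 <
  b.2) ->
  exists D : seq ('rV[R]_d * R), [/\ uniq D, {subset D <= s},
    trivIset [set` D] (fun b => euclid_ball b.1 b.2) &
    forall b, b \in s -> exists2 c, c \in D &
      euclid_ball b.1 b.2 `<=` euclid_ball c.1 (3 * c.2)].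
Proof.
pose LE b c := (b : 'rV[R]_d * R).2 <= (c : 'rV[R]_d * R).2.
have LE_trans : transitive LE by move=> x y z; exact: le_trans.
have triple b : 0 < b.2 -> euclid_ball b.1 b.2 `<=` euclid_ball b.1 (3 * b.2).
  by move=> b0; apply: euclid_ball_sub; rewrite subrr euclid_norm0; lra.
wlog : s / sorted LE s.
  move=> H spos; have : sorted LE (sort LE s) by apply: sort_sorted => x y;
    exact: le_total.
  move=> /H[b|D [uD Ds tD cD]]; first by rewrite mem_sort; exact: spos.
  exists D; split => // [b /Ds|b bs]; first by rewrite mem_sort.
  by apply: cD; rewrite mem_sort.
elim: s => [_ _|b s IH]; first by exists nil; split.
move=> /= bs spos.
have bmin c : c \in s -> b.2 <= c.2.
  by move=> cs; have /allP/(_ _ cs) := order_path_min LE_trans bs.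
have [c cs|D [uD Ds tD cD]] := IH (path_sorted bs); first by apply: spos;
  rewrite inE cs orbT.
have b0 : 0 < b.2 by apply: spos; rewrite mem_head.
have [[c cD' [z [bz cz]]]|disj] := pselect (exists2 c, c \in D &
    euclid_ball b.1 b.2 `&` euclid_ball c.1 c.2 !=set0).
  exists D; split => // [x /Ds|x]; first by rewrite inE orbC => ->.
  rewrite inE => /predU1P[->|/cD//]; exists c => //.
  apply: euclid_ball_sub.
  have bc := bmin _ (Ds _ cD').
  have := euclid_distD z c.1 b.1.
  rewrite (euclid_distC z); move: bz cz; rewrite /euclid_ball/=; lra.
have bD : b \notin D.
  apply/negP => bD; apply: disj; exists b => //; exists b.1; split;
    exact: euclid_ballxx.
exists (b :: D); split => //=.
- by rewrite bD.
- by move=> x; rewrite !inE => /predU1P[->|/Ds ->]; rewrite ?eqxx ?orbT.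
- move=> x y /=; rewrite !inE => /predU1P[->|xD] /predU1P[->|yD] //.
  + by move=> byz; exfalso; apply: disj; exists y.
  + by rewrite setIC => byz; exfalso; apply: disj; exists x.
  + exact: tD.
- move=> x; rewrite inE => /predU1P[->|/cD[c cD' xc]].
    by exists b; [rewrite mem_head|exact: triple].
  by exists c => //; rewrite inE cD' orbT.
Qed.

Local Open Scope ereal_scope.

Lemma measure_bigsetU_le (I : Type) (s : seq I) (F : I -> set (Rd R d)) :
  (forall i, measurable (F i)) ->
  mu (\big[setU/set0]_(i <- s) F i) <= \sum_(i <- s) mu (F i).
Proof.
move=> mF; elim: s => [|i s IH]; first by rewrite !big_nil measure0.
rewrite !big_cons; apply: le_trans (leeD2l _ IH).
by apply: measureU2 => //; exact: bigsetU_measurable.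
Qed.

(** The triples of the Vitali selection cover the union at the price of [3 ^+ d], and the selected
    balls are disjoint, so their integrals of [h] add up to at most the whole integral. *)
Lemma weak_type_finite h (t : R) (s : seq ('rV[R]_d * R)) :
  measurable_fun [set: Rd R d] h -> (forall x, 0 <= h x) -> (0 < t)%R ->
  (forall b, b \in s -> (0 < b.2)%R /\
     t%:E * mu (euclid_ball b.1 b.2) < \int[mu]_(y in euclid_ball b.1 b.2) h y)
       ->
  t%:E * mu (\big[setU/set0]_(b <- s) euclid_ball b.1 b.2) <=
    (3 ^+ d)%:E * \int[mu]_y h y.
Proof.
move=> mh h0 t0 sP.
have [b /sP[]//|D [uD Ds tD cD]] := @vitali_euclid_ball s.
have mB (a : R) b : measurable (euclid_ball b.1 (a * b.2)%R : set (Rd R d)).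
  exact: measurable_euclid_ball.
have mB1 b : measurable (euclid_ball b.1 b.2 : set (Rd R d)).
  exact: measurable_euclid_ball.
have le1 : mu (\big[setU/set0]_(b <- s) euclid_ball b.1 b.2) <=
    \sum_(b <- D) mu (euclid_ball b.1 (3 * b.2)%R).
  apply: le_trans (measure_bigsetU_le _ (mB 3%R)).
  apply: le_measure; rewrite ?inE; [exact: bigsetU_measurable..|].
  rewrite -!bigcup_seq => y [b /= bs yb]; have [c cD' /(_ _ yb) yc] := cD b bs.
  by exists c.
apply: le_trans (lee_wpmul2l _ le1) _; first by rewrite lee_fin ltW.
rewrite ge0_sume_distrr; last by move=> b _; exact: measure_ge0.
apply: (@le_trans _ _ (\sum_(b <- D) (3 ^+ d)%:E * \int[mu]_(y in euclid_ball
  b.1 b.2) h y)).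
  rewrite big_seq [leRHS]big_seq; apply: lee_sum => b /Ds/sP[b0 /ltW bh].
  rewrite lebesgue_ball ?mulr_gt0// exprMn -mulrA EFinM muleCA.
  by rewrite -(lebesgue_ball b.1 b0); apply: lee_wpmul2l => //;
    rewrite lee_fin exprn_ge0.
rewrite -ge0_sume_distrr; last by move=> b _; exact: integral_ge0.
apply: lee_wpmul2l; first by rewrite lee_fin exprn_ge0.
rewrite -ge0_integral_bigsetU//; last exact: measurable_funTS.
by apply: ge0_subset_integral => //; exact: bigsetU_measurable.
Qed.

Lemma exists_rat_euclid x (e : R) : (0 < e)%R ->
  exists q : 'rV[rat]_d, (euclid_norm (x - map_mx ratr q) < e)%R.
Proof.
move=> e0; have e1 : (0 < e / d.+1%:R)%R by rewrite divr_gt0.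
have [q xq] := exists_rat_vector x e1; exists q.
apply: (@le_lt_trans _ _ (d%:R * (e / d.+1%:R))%R).
  by apply: euclid_norm_le_coord => [|i]; [exact: ltW|rewrite !mxE ltW].
by rewrite mulrCA gtr_pMr// ltr_pdivrMr// mul1r ltr_nat.
Qed.

(** The set is covered by countably many rational balls, exhausted by finite lists. Since [mu] is
    here the outer measure, monotonicity bounds the set without a proof that it is measurable. *)
Lemma weak_type h (t : R) :
  measurable_fun [set: Rd R d] h -> (forall x, 0 <= h x) -> (0 < t)%R ->
  t%:E * mu [set x | exists2 r : R, (0 < r)%R &
     t%:E * mu (euclid_ball x r) < \int[mu]_(y in euclid_ball x r) h y] <=
  (6 ^+ d)%:E * \int[mu]_y h y.
Proof.
move=> mh h0 t0; set E := [set x | _].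
(* Enlarging a ball to a rational one at most doubles its radius; lowering the level by [2 ^+ d]
   absorbs this, and turns the final constant [3 ^+ d] into [6 ^+ d]. *)
pose t' : R := (t / 2 ^+ d)%R.
have t'0 : (0 < t')%R by rewrite divr_gt0// exprn_gt0.
pose conv (q : 'rV[rat]_d * rat) : 'rV[R]_d * R := (map_mx ratr q.1, ratr q.2).
pose good q := `[< (0 < (conv q).2)%R /\ t'%:E * mu (euclid_ball (conv q).1
  (conv q).2) <
   \int[mu]_(y in euclid_ball (conv q).1 (conv q).2) h y >].
pose s N := [seq conv q | q <- pmap unpickle (iota 0 N) & good q].
pose U N : set (Rd R d) := \big[setU/set0]_(b <- s N) euclid_ball b.1 b.2.
have mU N : measurable (U N).
  by apply: bigsetU_measurable => b _; exact: measurable_euclid_ball.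
have UE : E `<=` \bigcup_N U N.
  move=> x [r r0 xr].
  (* A centre within r/2 of [x] and a radius strictly between 3r/2 and 2r give a rational ball
     containing the ball of radius [r] about [x]. *)
  have [q xq] := exists_rat_euclid x (divr_gt0 r0 (ltr0Sn R 1)).
  have /rat_in_itvoo[w] : (r + r / 2 < 2 * r)%R by lra.
  rewrite in_itv/= => /andP[w1 w2].
  have w0 : (0 < ratr w :> R)%R by lra.
  exists (pickle (q, w)).+1 => //; rewrite /U -bigcup_seq.
  exists (conv (q, w)) => /=; last first.
    by rewrite /euclid_ball/= euclid_distC; lra.
  apply/mapP; exists (q, w) => //; rewrite mem_filter; apply/andP; split;
    last first.
    rewrite mem_pmap; apply/mapP; exists (pickle (q, w));
      last by rewrite pickleK.
    by rewrite mem_iota add0n ltnSn.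
  apply/asboolP; split => //=.
  apply: (@le_lt_trans _ _ (t%:E * mu (euclid_ball x r))).
    rewrite !lebesgue_ball// -!EFinM lee_fin /t' !mulrA.
    rewrite ler_wpM2r ?(ltW (unit_ball_volume_gt0 _ _))// -mulrA ler_wpM2l
      ?(ltW t0)//.
    by rewrite mulrC ler_pdivrMr ?exprn_gt0// -exprMn lerXn2r ?nnegrE; lra.
  apply: lt_le_trans xr _; apply: ge0_subset_integral.
  - exact: measurable_euclid_ball.
  - exact: measurable_euclid_ball.
  - exact: measurable_funTS.
  - by [].
  - by apply: euclid_ball_sub; rewrite euclid_distC; lra.
have bnd N : mu (U N) <= t'^-1%:E * ((3 ^+ d)%:E * \int[mu]_y h y).
  rewrite lee_pdivlMl//; apply: weak_type_finite => // b /mapP[q].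
  by rewrite mem_filter => /andP[/asboolP gq _] ->.
have ndU : nondecreasing_seq U.
  move=> m n mn; apply/subsetPset; rewrite /U -!bigcup_seq => x [b /= /mapP[q]].
  rewrite mem_filter => /andP[gq qm] -> xq; exists (conv q) => //=.
  apply: map_f; rewrite mem_filter gq; move: qm; rewrite !mem_pmap => /mapP[i].
  rewrite mem_iota add0n => im ->; apply: map_f.
  by rewrite mem_iota add0n (leq_trans im).
have mbU : measurable (\bigcup_N U N) by exact: bigcupT_measurable.
have lim := @nondecreasing_cvg_mu _ _ _ mu U mU mbU ndU.
rewrite -lee_pdivlMl//.
apply: (@le_trans _ _ (mu (\bigcup_N U N))); first exact: le_lebesgue_outer.
rewrite -(cvg_lim _ lim)//.
apply: (@le_trans _ _ (t'^-1%:E * ((3 ^+ d)%:E * \int[mu]_y h y))).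
  apply: lime_le; first by apply/cvg_ex; eexists; exact: lim.
  by apply: nearW => N; exact: bnd.
rewrite !muleA -!EFinM /t' (_ : _^-1 * _ = t^-1 * 6 ^+ d)%R//.
rewrite invf_div mulrAC -exprMn mulrC; congr (_ * _ ^+ _)%R; lra.
Qed.

End weak_type_inequality.

(** * From weak type bounds to L^p bounds along dyadic levels *)

Section strong_type.
Context (R : realType).

Lemma powR2_gt1 (q : R) : 0 < q -> 1 < 2 `^ q.
Proof.
move=> q0; apply: (@le_lt_trans _ _ (1 `^ q)); first by rewrite powR1.
by rewrite gt0_ltr_powR ?nnegrE// ltr1n.
Qed.

(** A geometric sum of ratio u = 2^q is at most u / (u - 1) times its last term, and the last term
    retained is below b^q. *)
Lemma dyadic_sum_le (q a b : R) (n : nat) : 0 < q -> 0 < a -> 0 < b ->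
  \sum_(k < n | 2 ^+ k * a < b) (2 ^+ k * a) `^ q <=
    2 `^ q / (2 `^ q - 1) * b `^ q.
Proof.
move=> q0 a0 b0; set u := 2 `^ q.
have u1 : 1 < u by exact: powR2_gt1.
have uE k : (2 ^+ k * a) `^ q = u ^+ k * a `^ q.
  rewrite powRM ?exprn_ge0 ?ltW//; congr (_ * _).
  by rewrite -[2 ^+ k]powR_mulrn// powRAC powR_mulrn ?powR_ge0.
have a0' : 0 <= a `^ q by exact: powR_ge0.
elim: n => [|n IH].
  by rewrite big_ord0 mulr_ge0 ?powR_ge0// divr_ge0 ?powR_ge0// subr_ge0 ltW.
have [nb|nb] := ltP (2 ^+ n * a) b; last first.
  by rewrite big_mkcond big_ord_recr/= -big_mkcond/= ltNge nb/= addr0.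
apply: (@le_trans _ _ (\sum_(k < n.+1) u ^+ k * a `^ q)).
  rewrite big_mkcond; apply: ler_sum => k _; rewrite uE; case: ifP => // _.
  by rewrite mulr_ge0// exprn_ge0// ltW// (lt_trans ltr01).
rewrite -mulr_suml.
have -> : \sum_(k < n.+1) u ^+ k = (u ^+ n.+1 - 1) / (u - 1).
  by rewrite subrX1 mulrC mulKf// subr_eq0 gt_eqF.
apply: (@le_trans _ _ (u / (u - 1) * (u ^+ n * a `^ q))).
  rewrite [leRHS]mulrA ler_wpM2r// [leRHS]mulrAC ler_wpM2r ?invr_ge0 ?subr_ge0
    ?(ltW u1)//.
  by rewrite -exprS gerBl.
rewrite ler_wpM2l//; first by rewrite divr_ge0 ?powR_ge0// subr_ge0 ltW.
by rewrite -uE ge0_ler_powR// ?nnegrE ?ltW// mulr_gt0 ?exprn_gt0.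
Qed.

Lemma dyadic_interval (a r : R) : 0 < a -> a < r ->
  exists k, 2 ^+ k * a < r <= 2 * (2 ^+ k * a).
Proof.
move=> a0 ar.
have ex : exists k, r <= 2 ^+ k.+1 * a.
  exists (Num.truncn (r / a)); rewrite -ler_pdivrMr//.
  apply: le_trans (ltW (truncnS_gt _)) _.
  by rewrite -natrX ler_nat ltnW// ltn_expl.
case: (ex_minnP ex) => k rk kmin; exists k.
rewrite mulrA -exprS rk andbT; case: k rk kmin => [|k] rk kmin.
  by rewrite expr0 mul1r.
by rewrite ltNge; apply/negP => /kmin; rewrite ltnn.
Qed.

Definition dyadic (a : R) (k : nat) : R := 2 ^+ k * a.

Local Open Scope ereal_scope.
Context d (T : measurableType d) (mu : {measure set T -> \bar R}).
Implicit Types (F g : T -> \bar R).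

Definition superlevel F (t : R) : set T := [set x | t%:E < F x].

Lemma measurable_level F (t : R) : measurable_fun [set: T] F -> measurable
  (superlevel F t).
Proof. by move=> mF; rewrite /superlevel -[X in measurable X]setTI;
  exact: emeasurable_fun_o_infty. Qed.

Lemma in_superlevel F (t : R) x : (x \in superlevel F t) = (t%:E < F x).
Proof. by apply/idP/idP => [/set_mem|xt]; [|exact/mem_set]. Qed.

(** The factor 2^p comes from bounding a function by twice the dyadic level below it; the last
    factor is the geometric sum of the levels below [4 * g x], with exponent [p - 1]. *)
Definition strong_constant (C p : R) : R :=
  (C * 2 `^ p * (2 `^ (p - 1) / (2 `^ (p - 1) - 1) * 4 `^ (p - 1)))%R.

(** When [F x] is finite, the single term with [dyadic a k < F x <= 2 * dyadic a k] is enough. *)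
Lemma dyadic_layers_le F (p a : R) (x : T) : (0 < p)%R -> (0 < a)%R ->
  (if a%:E < F x then F x `^ p else 0) <=
  \sum_(0 <= k <oo) (((2 * dyadic a k) `^ p)%:E *
     (\1_(superlevel F (dyadic a k)) x)%:E).
Proof.
move=> p0 a0.
have nneg k : 0 <= ((2 * dyadic a k) `^ p)%:E *
     (\1_(superlevel F (dyadic a k)) x)%:E.
  by rewrite -EFinM lee_fin mulr_ge0 ?powR_ge0.
case: ifPn => [|_]; last by apply: nneseries_ge0 => k _ _; exact: nneg.
have w_gt0 k : (0 < dyadic a k)%R by rewrite mulr_gt0 ?exprn_gt0.
case Fx : (F x) => [r| |]//.
  rewrite lte_fin => /(dyadic_interval a0)[k /andP[kr rk]].
  apply: le_trans (nneseries_lim_ge k.+1 _) => [|n _ _]; last exact: nneg.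
  rewrite big_nat_recr//= -[leLHS]add0e leeD//; first by apply: sume_ge0 =>
    i _; exact: nneg.
  rewrite indicE in_superlevel Fx lte_fin kr mule1 lee_fin.
  apply: ge0_ler_powR => //; rewrite ?nnegrE; first exact: ltW.
    exact: ltW (lt_trans (w_gt0 k) kr).
  by rewrite mulr_ge0// ltW.
(* When [F x] is infinite, every term is at least (2a)^p, so the partial sums exceed any [A]. *)
move=> _; rewrite poweRyr ?gt_eqF// leye_eq; apply/eqP/eqyP => A A0.
have v0 : (0 < (2 * a) `^ p)%R by apply: powR_gt0; rewrite mulr_gt0.
pose n := (Num.truncn (A / ((2 * a) `^ p))).+1.
apply: le_trans (nneseries_lim_ge n _) => [|k _ _]; last exact: nneg.
apply: (@le_trans _ _ (\sum_(0 <= k < n) ((2 * a) `^ p)%:E)).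
  rewrite sumEFin lee_fin sumr_const_nat subn0 -[leRHS]mulr_natl -ler_pdivrMr//.
  exact/ltW/truncnS_gt.
apply: lee_sum => k _; rewrite indicE in_superlevel Fx ltry mule1 lee_fin.
apply: ge0_ler_powR; rewrite ?nnegrE ?(ltW p0) ?mulr_ge0 ?(ltW a0) ?(ltW (w_gt0
  k))//.
by rewrite ler_pM2l// ler_peMl ?(ltW a0)// exprn_ege1// ler1n.
Qed.

(** At a fixed [x] only the levels below [4 * g x] contribute. Their geometric sum is of order
    g(x)^(p-1), with a positive exponent since p > 1, and the remaining factor [g x] completes the
    power. *)
Lemma dyadic_sum_levels_le g (p a : R) (x : T) : (1 < p)%R -> (0 < a)%R -> 0 <=
  g x ->
  \sum_(0 <= k <oo) ((dyadic a k `^ (p - 1))%:E *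
     (g \_ (superlevel g (dyadic a k / 4)%R)) x) <=
  (2 `^ (p - 1) / (2 `^ (p - 1) - 1) * 4 `^ (p - 1))%:E * g x `^ p.
Proof.
move=> p1 a0; have q0 : (0 < p - 1)%R by rewrite subr_gt0.
have u1 : (1 < 2 `^ (p - 1) :> R)%R by exact: powR2_gt1.
have c0 : (0 < 2 `^ (p - 1) / (2 `^ (p - 1) - 1) * 4 `^ (p - 1) :> R)%R.
  by rewrite mulr_gt0 ?powR_gt0// divr_gt0 ?powR_gt0// subr_gt0.
case gx : (g x) => [r| |]// r0; last first.
  by rewrite poweRyr ?gt_eqF ?(lt_trans ltr01)// gt0_muley ?lte_fin// leey.
rewrite lee_fin in r0; move: (r0); rewrite le_eqVlt => /predU1P[r00|rgt0].
  rewrite eseries0; first by rewrite mule_ge0 ?poweR_ge0// lee_fin ltW.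
  by move=> k _ _; rewrite patchE; case: ifP => _; rewrite ?gx -?r00 mule0.
apply: lime_le.
  apply: is_cvg_nneseries => k _ _; rewrite mule_ge0 ?lee_fin ?powR_ge0//.
  by rewrite patchE; case: ifP => _ //; rewrite gx lee_fin.
apply: nearW => n; rewrite big_mkord.
under eq_bigr => k _.
  rewrite patchE (_ : (if _ then _ else _) = (r * (dyadic a k < 4 *
    r)%R%:R)%:E); last first.
    rewrite in_superlevel gx lte_fin (mulrC 4%R) -ltr_pdivrMr//.
    by case: ifP => _; rewrite ?mulr1 ?mulr0.
  rewrite -EFinM mulrCA.
  over.
rewrite sumEFin poweR_EFin -EFinM lee_fin -mulr_sumr.
have r40 : (0 < 4 * r)%R by rewrite mulr_gt0.
apply: (@le_trans _ _ (r * (2 `^ (p - 1) / (2 `^ (p - 1) - 1) * (4 * r) `^ (p -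
  1)))%R).
  rewrite ler_wpM2l//; apply: le_trans (dyadic_sum_le n q0 a0 r40).
  rewrite [leRHS]big_mkcond/=; apply: ler_sum => k _.
  by rewrite /dyadic; case: ifP => _; rewrite ?mulr1 ?mulr0.
rewrite powRM// mulrCA -[leRHS]mulrA ler_wpM2l//.
  by rewrite divr_ge0 ?powR_ge0// subr_ge0 ltW.
rewrite mulrCA ler_wpM2l ?powR_ge0//.
by rewrite mulr_powRB1// (lt_trans ltr01).
Qed.

(* Summing the weak type bounds over the levels [2 ^+ k * a], k >= 0, controls
   [F ^ p] on the set [F > a], uniformly in [a]. *)
Lemma strong_type_of_weak_type F g (C p : R) :
  measurable_fun [set: T] F -> measurable_fun [set: T] g ->
  (forall x, 0 <= F x) -> (forall x, 0 <= g x) -> (0 <= C)%R -> (1 < p)%R ->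
  (forall t : R, (0 < t)%R ->
     t%:E * mu (superlevel F t) <=
     C%:E * \int[mu]_(x in superlevel g (t / 4)%R) g x) ->
  \int[mu]_x (F x `^ p) <= (strong_constant C p)%:E * \int[mu]_x (g x `^ p).
Proof.
move=> mF mg F0 g0 C0 p1 weak.
have p0 : (0 < p)%R by rewrite (lt_trans ltr01).
have mFp : measurable_fun [set: T] (fun x => F x `^ p).
  exact: (measurableT_comp (measurable_poweR p)).
have mgp : measurable_fun [set: T] (fun x => g x `^ p).
  exact: (measurableT_comp (measurable_poweR p)).
(* The truncation is needed because the dyadic levels start at [a]; it is removed at the end by
   letting [a] tend to 0. *)
pose Fa (a : R) x := if a%:E < F x then F x `^ p else 0.
have FaE a : Fa a = (fun x => F x `^ p) \_ (superlevel F a).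
  by apply/funext => x; rewrite /Fa patchE in_superlevel.
have mFa a : measurable_fun [set: T] (Fa a).
  rewrite FaE; apply/(measurable_restrictT _ (measurable_level a mF)).
  exact: measurable_funTS.
have Fa0 a x : 0 <= Fa a x by rewrite /Fa; case: ifP => // _; exact: poweR_ge0.
have Fa_le a : (0 < a)%R ->
    \int[mu]_x (Fa a x) <= (strong_constant C p)%:E * \int[mu]_x (g x `^ p).
  move=> a0; pose l := dyadic a.
  have l0 k : (0 < l k)%R by rewrite /l mulr_gt0 ?exprn_gt0.
  have mI k : measurable_fun [set: T] (fun x =>
    (\1_(superlevel F (l k)) x : R)%:E).
    by apply/measurable_EFinP; apply: measurable_indic; exact: measurable_level.
  have mG k : measurable_fun [set: T] (g \_ (superlevel g (l k / 4)%R)).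
    apply/(measurable_restrictT _ (measurable_level _ mg));
      exact: measurable_funTS.
  have G0 k x : 0 <= (g \_ (superlevel g (l k / 4)%R)) x by exact:
    erestrict_ge0.
  apply: (@le_trans _ _ (\int[mu]_x \sum_(0 <= k <oo) (((2 * l k) `^ p)%:E *
     (\1_(superlevel F (l k)) x)%:E))).
    apply: ge0_le_integral => //.
    - apply: (@ge0_emeasurable_sum _ _ _ _ (fun k x => ((2 * l k) `^ p)%:E *
        (\1_(superlevel F (l k)) x)%:E) xpredT) => [k x _ _|k _].
        by rewrite -EFinM lee_fin mulr_ge0 ?powR_ge0.
      exact: measurable_funeM.
    - by move=> x _; exact: dyadic_layers_le.
  rewrite integral_nneseries//; last 2 first.
  - by move=> k; exact: measurable_funeM.
  - by move=> k x _; rewrite -EFinM lee_fin mulr_ge0 ?powR_ge0.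
  apply: (@le_trans _ _ (\sum_(0 <= k <oo) ((C * 2 `^ p)%:E *
      \int[mu]_x ((l k `^ (p - 1))%:E * (g \_ (superlevel g (l k / 4)%R)) x)))).
    apply: lee_nneseries => [k _ _|k _].
      by apply: integral_ge0 => x _; rewrite -EFinM lee_fin mulr_ge0 ?powR_ge0.
    rewrite ge0_integralZl_EFin ?powR_ge0//.
    rewrite ge0_integralZl_EFin ?powR_ge0//.
    rewrite integral_indic//; last exact: measurable_level.
    rewrite setIT -integral_mkcond.
    (* One factor [l k] is split off to be consumed by the weak type bound at that level. *)
    have -> : ((2 * l k) `^ p)%:E = (2 `^ p * l k `^ (p - 1))%:E * (l k)%:E.
      by rewrite -EFinM -mulrA (mulrC (_ `^ _)%R (l k)) mulr_powRB1 ?powRM ?ltW.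
    rewrite -muleA; apply: le_trans (lee_wpmul2l _ (weak _ (l0 k))) _.
      by rewrite lee_fin mulr_ge0 ?powR_ge0.
    by rewrite !muleA -!EFinM mulrAC (mulrC C).
  rewrite nneseriesZl; last first.
    by move=> k _; apply: integral_ge0 => x _;
      rewrite mule_ge0// lee_fin powR_ge0.
  rewrite (EFinM (C * 2 `^ p)) -[leRHS]muleA; apply: lee_wpmul2l.
    by rewrite lee_fin mulr_ge0 ?powR_ge0.
  rewrite -integral_nneseries//; last 2 first.
  - by move=> k; exact: measurable_funeM.
  - by move=> k x _; rewrite mule_ge0// lee_fin powR_ge0.
  have u1 : (1 < 2 `^ (p - 1) :> R)%R.
    by apply: powR2_gt1; rewrite subr_gt0.
  rewrite -ge0_integralZl_EFin//; last 2 first.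
  - by move=> x _; exact: poweR_ge0.
  - by rewrite mulr_ge0 ?powR_ge0// divr_ge0 ?powR_ge0// subr_ge0 ltW.
  apply: ge0_le_integral => //.
  - move=> x _; apply: nneseries_ge0 => k _ _.
    by rewrite mule_ge0// lee_fin powR_ge0.
  - apply: (@ge0_emeasurable_sum _ _ _ _ (fun k x => (l k `^ (p - 1))%:E *
        (g \_ (superlevel g (l k / 4)%R)) x) xpredT) => [k x _ _|k _].
      by rewrite mule_ge0// lee_fin powR_ge0.
    exact: measurable_funeM.
  - exact: measurable_funeM.
  - by move=> x _; exact: dyadic_sum_levels_le.
(* At each point the truncated sequence is eventually constant; it is also nondecreasing, so
   monotone convergence applies. *)
have limE x : limn (fun n => Fa (n.+1%:R^-1)%R x) = F x `^ p.
  apply: cvg_lim => //; apply: cvg_near_cst.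
  have := F0 x; rewrite le_eqVlt => /predU1P[Fx|Fx].
    by apply: nearW => n; rewrite /Fa -Fx poweR0r ?gt_eqF//; case: ifP.
  have [e e0 eF] : exists2 e : R, (0 < e)%R & e%:E < F x.
    case: (F x) Fx => [r| |]//; last by exists 1%R; rewrite ?ltry.
    by rewrite lte_fin => r0; exists (r / 2)%R; rewrite ?lte_fin; lra.
  near=> n; rewrite /Fa ifT//; apply: lt_trans eF; rewrite lte_fin.
  by near: n; exact: (near_infty_natSinv_lt (PosNum e0)).
under eq_integral => x _ do rewrite -limE.
rewrite (monotone_convergence mu measurableT (fun n => mFa (n.+1%:R^-1)%R))//;
  last first.
  move=> x _ m n mn; rewrite /Fa; case: ifPn => h; last by case: ifP => _ //;
    exact: poweR_ge0.
  rewrite ifT//; apply: le_lt_trans h; rewrite lee_fin lef_pV2 ?posrE//.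
  by rewrite ler_nat.
apply: lime_le; last by apply: nearW => n; exact: Fa_le.
apply: ereal_nondecreasing_is_cvgn => m n mn; apply: ge0_le_integral => // x _.
rewrite /Fa; case: ifPn => h; last by case: ifP => _ //; exact: poweR_ge0.
rewrite ifT//; apply: le_lt_trans h; rewrite lee_fin lef_pV2 ?posrE//.
by rewrite ler_nat.
Unshelve. all: by end_near. Qed.

End strong_type.

(** * Kernel estimates and measurability of the log-maximal function *)

Section log_maximal_function.
Context (R : realType) (d : nat).
Notation mu := (@lebesgue R d).
Implicit Types (x : 'rV[R]_d) (f : 'rV[R]_d -> R) (h : Rd R d -> \bar R).
Local Open Scope ereal_scope.

Let mB x r : measurable (euclid_ball x r : set (Rd R d)).
Proof. exact: measurable_euclid_ball. Qed.

Definition ball_volume (r : R) : R := (r ^+ d * unit_ball_volume R d)%R.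

Lemma ball_volume_gt0 r : (0 < r)%R -> (0 < ball_volume r)%R.
Proof. by move=> r0; rewrite mulr_gt0 ?exprn_gt0// unit_ball_volume_gt0. Qed.

Lemma lebesgue_ball_volume x r : (0 < r)%R ->
  mu (euclid_ball x r) = (ball_volume r)%:E.
Proof. exact: lebesgue_ball. Qed.

(** Lower semicontinuity in the centre: some concentric ball of radius r - 1/(n+1) already has
    integral above [a], and it stays inside the ball of radius [r] when the centre moves by less
    than 1/(n+1). *)
Lemma lt_ball_integral_open h x (r : R) (a : \bar R) :
  measurable_fun [set: Rd R d] h -> (forall y, 0 <= h y) -> 
  a < \int[mu]_(y in euclid_ball x r) h y ->
  exists2 e : R, (0 < e)%R &
    forall z, euclid_ball x e z -> a < \int[mu]_(y in euclid_ball z r) h y.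
Proof.
move=> mh h0 ax.
pose F (n : nat) : set (Rd R d) := euclid_ball x (r - n.+1%:R^-1).
have ndF : nondecreasing_seq F.
  move=> m n mn; apply/subsetPset; apply: euclid_ball_sub.
  by rewrite subrr euclid_norm0 add0r lerD2l lerN2 lef_pV2 ?posrE// ler_nat.
have FE : \bigcup_n F n = euclid_ball x r.
  apply/seteqP; split => [y [n _]|y xy].
    by apply: euclid_ball_sub; rewrite subrr euclid_norm0 add0r gerBl.
  have rxy : (0 < r - euclid_norm (x - y))%R by rewrite subr_gt0.
  have [n _ /(_ n (leqnn n))] := near_infty_natSinv_lt (PosNum rxy).
  by move=> /= ne; exists n => //; rewrite /F /euclid_ball/= ltrBrDr -ltrBrDl.
have cvF : \int[mu]_(y in F n) h y @[n --> \oo] --> \int[mu]_(y in euclid_ball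
  x r) h y.
  rewrite -FE; apply: ge0_nondecreasing_set_cvg_integral => //.
  - by move=> n; exact: mB.
  - by move=> n; exact: measurable_funTS.
have [n an] : exists n, a < \int[mu]_(y in F n) h y.
  apply: contrapT => /forallNP Fa; move: ax;
    rewrite -(cvg_lim _ cvF)// ltNge => /negP; apply.
  apply: lime_le; first by apply/cvg_ex; eexists; exact: cvF.
  by apply: nearW => n; rewrite leNgt; apply/negP; exact: Fa.
exists (n.+1%:R^-1)%R => // z xz; apply: lt_le_trans an _.
apply: ge0_subset_integral; [exact: mB|exact: mB|exact: measurable_funTS|by
  []|].
apply: euclid_ball_sub; rewrite euclid_distC; move: xz; rewrite /euclid_ball/=.
by move: (_ ^-1)%R (euclid_norm _) => u v; lra.
Qed.

Section kernel.
Variables (s : R) (f : 'rV[R]_d -> R).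
Hypothesis mf : measurable_fun [set: Rd R d] (f : Rd R d -> R).

(** The value [f x] is replaced by a free real [t], so that it can be frozen while the centre of the
    ball moves. *)
Definition log_kernel (t r : R) (y : Rd R d) : \bar R := (ln (1 + `|t - f y| /
  r `^ s))%:E.

Lemma log_kernel_ge0 t r y : 0 <= log_kernel t r y.
Proof. by rewrite lee_fin ln_ge0// lerDl divr_ge0 ?powR_ge0. Qed.

Lemma measurable_log_kernel t r : measurable_fun [set: Rd R d] (log_kernel t r).
Proof.
have m1 : measurable_fun [set: Rd R d] (fun y : Rd R d => (t - f y)%R).
  by apply: measurable_funB; [exact: measurable_cst|exact: mf].
have m2 : measurable_fun [set: Rd R d] (fun y : Rd R d => (`|t - f y|)%R).
  exact: (measurableT_comp (@normr_measurable R setT) m1).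
have m3 : measurable_fun [set: Rd R d] (fun y : Rd R d =>
  (1 + `|t - f y| / r `^ s)%R).
  apply: measurable_funD; first exact: measurable_cst.
  by apply: measurable_funM; [exact: m2|exact: measurable_cst].
apply/measurable_EFinP; exact: (measurableT_comp (@measurable_ln R) m3).
Qed.

Let mK t r D : measurable_fun D (log_kernel t r).
Proof. by apply: measurable_funTS; exact: measurable_log_kernel. Qed.

(** The triangle inequality combined with 1 + a + b <= (1 + a)(1 + b) for nonnegative a and b. *)
Lemma ln1D_dist_triangle (t u v c : R) : (0 < c)%R ->
  (ln (1 + `|t - v| / c) <= ln (1 + `|t - u| / c) + ln (1 + `|v - u| / c))%R.
Proof.
move=> c0.
have p1 (w : R) : (0 < 1 + `|w| / c)%R by rewrite ltr_pwDl// divr_ge0// ltW.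
rewrite -lnM ?posrE// ler_ln ?posrE ?mulr_gt0//.
rewrite mulrDl mul1r mulrDr mulr1 -!addrA lerD2l.
apply: (@le_trans _ _ (`|v - u| / c + `|t - u| / c)%R).
  rewrite -mulrDl ler_wpM2r ?invr_ge0 ?(ltW c0)//.
  by rewrite [leRHS]addrC (distrC v) ler_distD.
by rewrite lerD2l lerDl mulr_ge0// divr_ge0// ltW.
Qed.

Lemma log_kernel_integral_shift t q x r : (0 < r)%R ->
  \int[mu]_(y in euclid_ball x r) log_kernel t r y <=
  \int[mu]_(y in euclid_ball x r) log_kernel q r y +
    (`|t - q| / r `^ s * ball_volume r)%:E.
Proof.
move=> r0; have rs0 : (0 < r `^ s)%R by exact: powR_gt0.
have c0 : (0 <= `|t - q| / r `^ s)%R by rewrite divr_ge0// ltW.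
rewrite EFinM -(lebesgue_ball_volume x r0) -integral_cst; last exact: mB.
rewrite -ge0_integralD; last 5 first.
- exact: mB.
- by move=> y _; exact: log_kernel_ge0.
- exact: mK.
- by move=> y _; rewrite lee_fin.
- exact: measurable_cst.
apply: ge0_le_integral; [exact: mB|by move=> y _;
  exact: log_kernel_ge0|exact: mK| |].
  by apply: emeasurable_funD; [exact: mK|exact: measurable_cst].
move=> y _; rewrite /log_kernel/= -EFinD lee_fin.
apply: le_trans (ln1D_dist_triangle t q (f y) rs0) _.
rewrite addrC (distrC (f y)) lerD2l.
by apply: le_ln1Dx; rewrite (lt_le_trans _ c0)// ltrN10.
Qed.

Lemma log_maximal_gtP (a : R) x : a%:E < log_maximal s f x <->
  exists2 r : R, (0 < r)%R &
    (a * ball_volume r)%:E < \int[mu]_(y in euclid_ball x r) log_kernel (f x) r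
      y.
Proof.
have E r : (0 < r)%R -> (lebesgue (euclid_ball x r))^-1 *
    \int[mu]_(y in euclid_ball x r) log_kernel (f x) r y =
    (ball_volume r)^-1%:E * \int[mu]_(y in euclid_ball x r) log_kernel (f x) r
      y.
  by move=> r0; rewrite lebesgue_ball_volume// inver gt_eqF// ball_volume_gt0.
split=> [/ereal_sup_gt[_ [r /= r0 <-]]|[r r0 ar]].
  rewrite [X in _ < X](E _ r0) lte_pdivlMl ?ball_volume_gt0// -EFinM mulrC =>
    ar.
  by exists r.
apply: (@lt_le_trans _ _ ((ball_volume r)^-1%:E * \int[mu]_(y in euclid_ball x
  r) log_kernel (f x) r y)).
  by rewrite lte_pdivlMl ?ball_volume_gt0// -EFinM mulrC.
by rewrite -E//; apply: ereal_sup_ubound; exists r.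
Qed.

Lemma log_kernel_integral_le x (r : R) : (0 < r)%R ->
  \int[mu]_(y in euclid_ball x r) log_kernel (f x) r y <=
  (ball_volume r)%:E * log_maximal s f x.
Proof.
move=> r0; rewrite -lee_pdivrMl ?ball_volume_gt0//.
have -> : (ball_volume r)^-1%:E = (lebesgue (euclid_ball x r))^-1.
  by rewrite lebesgue_ball_volume// inver gt_eqF// ball_volume_gt0.
by apply: ereal_sup_ubound; exists r.
Qed.

Lemma log_maximal_ge0 x : 0 <= log_maximal s f x.
Proof.
have := log_kernel_integral_le x ltr01.
rewrite -lee_pdivrMl ?ball_volume_gt0//; apply: le_trans.
apply: mule_ge0; first by rewrite lee_fin invr_ge0 ltW// ball_volume_gt0.
by apply: integral_ge0 => y _; exact: log_kernel_ge0.
Qed.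

(* Freezing the value [f x] at a nearby rational [q] makes the averages lower
   semicontinuous in [x], so the superlevel sets of the supremum over the
   uncountable family of radii are countable unions of measurable sets. *)
Lemma measurable_log_maximal : measurable_fun [set: Rd R d] (log_maximal s f).
Proof.
apply: (measurability _ (ErealGenOInfty.measurableE R)).
move=> /= _ [_ [a ->]] <-; rewrite setTI preimage_itvoy.
pose del (n : nat) : R := (n.+1%:R^-1)%R.
have del0 n : (0 < del n)%R by rewrite /del.
(* The slack in the threshold pays for returning from [q] to [f x] when the two differ by less than
   [del n]. *)
pose U (q : rat) (n : nat) : set (Rd R d) := [set x | exists2 r : R, (0 < r)%R &
  ((a + del n / r `^ s) * ball_volume r)%:E <
    \int[mu]_(y in euclid_ball x r) log_kernel (ratr q) r y].
have mU q n : measurable (U q n).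
  apply: measurable_euclid_open => x [r r0 xr].
  have [e e0 eP] := lt_ball_integral_open (measurable_log_kernel _ _)
    (log_kernel_ge0 _ _) xr.
  by exists e => // z /eP; exists r.
pose V (q : rat) (n : nat) : set (Rd R d) := [set x | (`|f x - ratr q| < del
  n)%R].
have mV q n : measurable (V q n).
  rewrite (_ : V q n = f @^-1` ball (ratr q : R) (del n)); last first.
    by apply/seteqP; split => x; rewrite /V/= /ball/= distrC.
  by rewrite -[X in measurable X]setTI; apply: mf => //; exact: measurable_ball.
rewrite (_ : [set x | _] = \bigcup_(qn in [set: rat * nat]) (V qn.1 qn.2 `&` U
  qn.1 qn.2)).
  apply: countable_bigcupT_measurable => [|qn]; first exact: countableP.
  exact: measurableI.
apply/seteqP; split => [x /= /log_maximal_gtP[r r0]|x [[q n] _ [/= xV [r r0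
  xr]]]]; last first.
  apply/log_maximal_gtP; exists r => //.
  have := lt_le_trans xr (log_kernel_integral_shift (ratr q) (f x) x r0).
  rewrite mulrDl EFinD => h.
  rewrite -(@lteD2rE _ ((`|ratr q - f x| / r `^ s * ball_volume r)%:E))//.
  apply: le_lt_trans h; rewrite leeD2l// lee_fin.
  rewrite ler_wpM2r ?(ltW (ball_volume_gt0 r0))// ler_wpM2r ?invr_ge0
    ?powR_ge0//.
  by rewrite distrC ltW.
set I := integral _ _ _ => aI; set v := ball_volume r in aI.
have v0 : (0 < v)%R by exact: ball_volume_gt0.
have rs0 : (0 < r `^ s)%R by exact: powR_gt0.
have [e e0 eI] : exists2 e : R, (0 < e)%R & ((a + e) * v)%:E < I.
  case: I aI => [I| |]//; last by exists 1%R; rewrite ?ltry.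
  rewrite lte_fin => aI; exists ((I / v - a) / 2)%R.
    by rewrite divr_gt0// subr_gt0 ltr_pdivlMr.
  rewrite lte_fin -ltr_pdivlMr//; move: aI; rewrite -ltr_pdivlMr//.
  by move: (I / v)%R => z; lra.
(* The room [e] is spent twice, on the slack in [U] and on freezing [f x] at [q], hence the half. *)
have e1 : (0 < e / 2 * r `^ s)%R by rewrite mulr_gt0// divr_gt0.
have [n _ /(_ n (leqnn n))/= ne] := near_infty_natSinv_lt (PosNum e1).
have nd : (del n / r `^ s < e / 2)%R by rewrite ltr_pdivrMr.
have /rat_in_itvoo[q] : (f x - del n < f x + del n)%R by rewrite ltrD2l gtrN.
rewrite in_itv/= -ltr_distlC => xq.
exists (q, n) => //=; split; first by rewrite /V/= .
exists r => //; rewrite -/v.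
have := lt_le_trans eI (log_kernel_integral_shift (f x) (ratr q) x r0).
rewrite -/v => h.
rewrite -(@lteD2rE _ ((`|f x - ratr q| / r `^ s * v)%:E))//.
apply: le_lt_trans h; rewrite -EFinD lee_fin -mulrDl ler_wpM2r ?(ltW v0)//.
rewrite -addrA lerD2l.
have : (`|f x - ratr q| / r `^ s <= del n / r `^ s)%R.
  by rewrite ler_wpM2r ?invr_ge0 ?powR_ge0// ltW.
move: nd; lra.
Qed.

End kernel.
End log_maximal_function.

(** * The two comparisons between admissible functions and the log-maximal function *)

Section equivalence.
Context (R : realType) (d : nat).
Notation mu := (@lebesgue R d).
Implicit Types (x : 'rV[R]_d) (f : 'rV[R]_d -> R) (g : 'rV[R]_d -> \bar R).
Local Open Scope ereal_scope.

Let mB x r : measurable (euclid_ball x r : set (Rd R d)).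
Proof. exact: measurable_euclid_ball. Qed.

(** The logarithm of the admissibility inequality, after bounding |x - y|^s by r^s. At [y = x]
    admissibility says nothing, but the kernel vanishes. *)
Lemma log_kernel_le_admissible (s p : R) f g x (r : R) y :
  (0 < s)%R -> (0 < r)%R -> admissible s p f g -> euclid_ball x r y ->
  log_kernel s f (f x) r y <= g x + g y.
Proof.
move=> s0 r0 [g0 _ gP] xy; have gxy0 : 0 <= g x + g y by apply: adde_ge0;
  exact: g0.
have rs0 : (0 < r `^ s)%R by exact: powR_gt0.
have [xy0|neq] := eqVneq x y.
  by rewrite /log_kernel xy0 subrr normr0 mul0r addr0 ln1; exact: adde_ge0.
have := gP _ _ neq; rewrite /log_kernel.
case: (g x + g y) gxy0 => [G| |]//; last by move=> *; rewrite leey.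
rewrite lee_fin => G0; rewrite -EFinB -EFinM !lee_fin => le1.
rewrite -[leRHS]expRK ler_ln ?posrE ?expR_gt0//; last first.
  by rewrite ltr_pwDl// divr_ge0// ltW.
rewrite addrC -lerBrDr ler_pdivrMr// mulrC (le_trans le1)//.
apply: ler_wpM2r; first by rewrite subr_ge0 -expR0 ler_expR.
by apply: ge0_ler_powR; rewrite ?nnegrE ?euclid_norm_ge0 ?(ltW s0) ?(ltW r0)//
  ltW.
Qed.

(** Let [h] be [g] cut to the set where it exceeds t/4, so that g <= h + t/4. Where g(x) <= t/2, the
    kernel is at most h + 3t/4, and an average above [t] forces an average of [h] above t/4.
    Chebyshev at level t/2 gives the constant 2, and the weak type inequality at level t/4 gives
    [4 * 6 ^+ d]. *)
Lemma weak_type_log_maximal (s p : R) f g (t : R) :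
  (0 < s)%R -> measurable_fun [set: Rd R d] (f : Rd R d -> R) ->
  admissible s p f g -> (0 < t)%R ->
  t%:E * mu (superlevel (log_maximal s f : Rd R d -> \bar R) t) <=
  (2 + 4 * 6 ^+ d)%:E * \int[mu]_(x in superlevel (g : Rd R d -> \bar R) (t /
    4)%R) g x.
Proof.
move=> s0 mf adm t0; have [g0 [mg _] _] := adm.
pose G : Rd R d -> \bar R := g.
pose A u := superlevel G u.
have mA u : measurable (A u) by exact: measurable_level.
pose h : Rd R d -> \bar R := G \_ (A (t / 4)%R).
have mh : measurable_fun [set: Rd R d] h.
  by apply/(measurable_restrictT _ (mA _)); exact: measurable_funTS.
have h0 x : 0 <= h x by exact: erestrict_ge0.
have gh x : g x <= h x + (t / 4)%:E.
  rewrite /h patchE in_superlevel; case: ifPn => [_|];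
    first by rewrite leeDl// lee_fin divr_ge0// ltW.
  by rewrite -leNgt add0e.
have t40 : (0 < t / 4)%R by rewrite divr_gt0.
have t20 : (0 < t / 2)%R by rewrite divr_gt0.
set E := [set x | exists2 r : R, (0 < r)%R &
     (t / 4)%:E * mu (euclid_ball x r) < \int[mu]_(y in euclid_ball x r) h y].
have sub : superlevel (log_maximal s f : Rd R d -> \bar R) t `<=` A (t / 2)%R
  `|` E.
  move=> x /(log_maximal_gtP _ _ _ _)[r r0 tr].
  have [|gx] := ltP (t / 2)%:E (g x); [by left|right; exists r => //].
  have v0 := ball_volume_gt0 d r0.
  rewrite lebesgue_ball_volume//.
  have le2 : \int[mu]_(y in euclid_ball x r) log_kernel s f (f x) r y <=
      \int[mu]_(y in euclid_ball x r) h y + (3 / 4 * t * ball_volume d r)%:E.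
    rewrite EFinM -(lebesgue_ball_volume x r0) -integral_cst; last exact: mB.
    rewrite -ge0_integralD; last 5 first.
    - exact: mB.
    - by [].
    - exact: measurable_funTS.
    - by move=> y _; rewrite lee_fin mulr_ge0// ltW.
    - exact: measurable_cst.
    apply: ge0_le_integral.
    - exact: mB.
    - by move=> y _; exact: log_kernel_ge0.
    - by apply: measurable_funTS; exact: measurable_log_kernel.
    - by apply: emeasurable_funD; [exact: measurable_funTS|exact:
      measurable_cst].
    - move=> y xy; apply: le_trans (log_kernel_le_admissible s0 r0 adm xy) _.
      apply: le_trans (leeD gx (gh y)) _.
      rewrite addeCA; apply: leeD2l; rewrite /= -EFinD lee_fin; lra.
  have lt2 := lt_le_trans tr le2.
  rewrite -(@lteD2rE _ ((3 / 4 * t * ball_volume d r)%:E))//;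
    apply: le_lt_trans lt2.
  by rewrite -EFinM -EFinD lee_fin -mulrDl ler_wpM2r ?(ltW v0)//; lra.
(* Chebyshev, with the domain then enlarged to the one used for [h]. *)
have le_A : (t / 2)%:E * mu (A (t / 2)%R) <= \int[mu]_(x in A (t / 4)%R) G x.
  rewrite -integral_cst; last exact: mA.
  apply: (@le_trans _ _ (\int[mu]_(x in A (t / 2)%R) G x)).
    apply: ge0_le_integral; [exact: mA| | |exact: measurable_funTS|].
    - by move=> x _; rewrite lee_fin ltW.
    - exact: measurable_cst.
    - by move=> x /ltW.
  apply: ge0_subset_integral; [exact: mA|exact: mA|exact: measurable_funTS|by
    []|].
  by move=> x; apply: lt_trans; rewrite lte_fin; lra.
have le_E := weak_type mh h0 t40; rewrite -/E in le_E.
rewrite /h -integral_mkcond in le_E.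
have le_U : mu (superlevel (log_maximal s f : Rd R d -> \bar R) t) <= mu (A (t
  / 2)%R) + mu E.
  apply: le_trans (le_lebesgue_outer sub) _; exact: outer_measureU2.
apply: le_trans (lee_wpmul2l _ le_U) _; first by rewrite lee_fin ltW.
rewrite ge0_muleDr; [|exact: measure_ge0|exact: lebesgue_outer_ge0].
have int0 : 0 <= \int[mu]_(x in A (t / 4)%R) G x by exact: integral_ge0.
rewrite EFinD ge0_muleDl ?lee_fin ?mulr_ge0 ?exprn_ge0//; apply: leeD.
  rewrite [X in X%:E * _](_ : t = 2 * (t / 2))%R; last by lra.
  by rewrite [(2 * (t / 2))%:E]EFinM -muleA; apply: lee_wpmul2l.
rewrite [X in X%:E * _](_ : t = 4 * (t / 4))%R; last by lra.
by rewrite [(4 * (t / 4))%:E]EFinM [(4 * 6 ^+ d)%:E]EFinM -!muleA;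
  apply: lee_wpmul2l.
Qed.

Lemma Lnorm_le_of_integral (K p : R) (F G : Rd R d -> \bar R) :
  (0 < p)%R -> (0 <= K)%R -> (forall x, 0 <= F x) -> (forall x, 0 <= G x) ->
  \int[mu]_x (F x `^ p) <= K%:E * \int[mu]_x (G x `^ p) ->
  'N[mu]_p%:E[F] <= (K `^ p^-1)%:E * 'N[mu]_p%:E[G].
Proof.
move=> p0 K0 F0 G0 FG; rewrite unlock.
under eq_integral do rewrite gee0_abs//.
under [in leRHS]eq_integral do rewrite gee0_abs//.
have ip0 : (0 <= p^-1)%R by rewrite invr_ge0 ltW.
have iF : 0 <= \int[mu]_x (F x `^ p) by apply: integral_ge0 => x _;
  exact: poweR_ge0.
have iG : 0 <= \int[mu]_x (G x `^ p) by apply: integral_ge0 => x _;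
  exact: poweR_ge0.
rewrite -poweR_EFin -poweRM//.
by apply: gt0_ler_poweR => //; rewrite in_itv/= ?iF ?leey//= mule_ge0.
Qed.

Definition admissible_constant (p : R) : R := (strong_constant (2 + 4 * 6 ^+ d)
  p `^ p^-1)%R.

Lemma log_maximal_Lnorm_le (s p : R) f g : (0 < s)%R -> (1 < p)%R ->
  measurable_fun [set: Rd R d] (f : Rd R d -> R) -> admissible s p f g ->
  'N[mu]_p%:E[log_maximal s f] <= (admissible_constant p)%:E * 'N[mu]_p%:E[g].
Proof.
move=> s0 p1 mf adm; have [g0 [mg _] _] := adm.
have C0 : (0 <= 2 + 4 * 6 ^+ d :> R)%R by rewrite addr_ge0// mulr_ge0//
  exprn_ge0.
have u1 : (1 < 2 `^ (p - 1) :> R)%R by apply: powR2_gt1; rewrite subr_gt0.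
apply: Lnorm_le_of_integral => //.
- by rewrite (lt_trans ltr01).
- by rewrite !mulr_ge0 ?powR_ge0// invr_ge0 subr_ge0 ltW.
- exact: log_maximal_ge0.
apply: strong_type_of_weak_type => //;
  [exact: measurable_log_maximal|exact: log_maximal_ge0|].
by move=> t t0; exact: weak_type_log_maximal adm t0.
Qed.

(* Averaging over [z] in the ball of radius |x - y| / 2 about the midpoint,
  which
   lies in both balls of radius |x - y| about [x] and [y]. *)
Lemma log_diff_le_log_maximal (s : R) f x y :
  measurable_fun [set: Rd R d] (f : Rd R d -> R) -> x != y ->
  (ln (1 + `|f x - f y| / euclid_norm (x - y) `^ s))%:E <=
  (2 ^+ d)%:E * log_maximal s f x + (2 ^+ d)%:E * log_maximal s f y.
Proof.
move=> mf xy; set r := euclid_norm (x - y).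
have r0 : (0 < r)%R by rewrite lt0r euclid_norm_eq0 subr_eq0 xy euclid_norm_ge0.
have r20 : (0 < r / 2)%R by rewrite divr_gt0.
have rs0 : (0 < r `^ s)%R by exact: powR_gt0.
have v0 := ball_volume_gt0 d r20.
pose m := (2^-1 *: (x + y))%R.
have mx : euclid_norm (x - m) = (r / 2)%R.
  rewrite (_ : x - m = 2^-1 *: (x - y))%R; last by apply/rowP => i;
    rewrite !mxE; lra.
  by rewrite euclid_normZ ger0_norm ?invr_ge0// mulrC.
have my : euclid_norm (y - m) = (r / 2)%R.
  rewrite (_ : y - m = 2^-1 *: (y - x))%R; last by apply/rowP => i;
    rewrite !mxE; lra.
  by rewrite euclid_normZ ger0_norm ?invr_ge0// mulrC euclid_distC.
have subx : euclid_ball m (r / 2) `<=` euclid_ball x r.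
  by apply: euclid_ball_sub; rewrite mx; lra.
have suby : euclid_ball m (r / 2) `<=` euclid_ball y r.
  by apply: euclid_ball_sub; rewrite my; lra.
have mK t : measurable_fun [set: Rd R d] (log_kernel s f t r) by exact:
  measurable_log_kernel.
have k0 t z : 0 <= log_kernel s f t r z by exact: log_kernel_ge0.
set L := (ln _)%:E.
(* This volume ratio is the source of the factor [2 ^+ d]. *)
have vE : ball_volume d r = (2 ^+ d * ball_volume d (r / 2))%R.
  by rewrite /ball_volume mulrA -exprMn mulrCA divff ?mulr1.
have step z : euclid_ball m (r / 2) `<=` euclid_ball z r ->
    \int[mu]_(w in euclid_ball m (r / 2)) log_kernel s f (f z) r w <=
    (ball_volume d (r / 2))%:E * ((2 ^+ d)%:E * log_maximal s f z).
  move=> sub; rewrite muleA -EFinM [(ball_volume _ _ * _)%R]mulrC -vE.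
  apply: le_trans (log_kernel_integral_le _ _ _ r0).
  by apply: ge0_subset_integral;
    [exact: mB|exact: mB|exact: measurable_funTS|by []|].
suff : (ball_volume d (r / 2))%:E * L <= (ball_volume d (r / 2))%:E *
    ((2 ^+ d)%:E * log_maximal s f x + (2 ^+ d)%:E * log_maximal s f y).
  by rewrite lee_pmul2l// fin_numE.
rewrite [leRHS]ge0_muleDr ?mule_ge0 ?log_maximal_ge0 ?lee_fin ?exprn_ge0//.
rewrite -(lebesgue_ball_volume m r20) muleC -integral_cst; last exact: mB.
rewrite (lebesgue_ball_volume m r20).
apply: (@le_trans _ _ (\int[mu]_(w in euclid_ball m (r / 2))
    (log_kernel s f (f x) r w + log_kernel s f (f y) r w))).
  apply: ge0_le_integral; [exact: mB| |exact: measurable_cst| |].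
  - by move=> z _; rewrite lee_fin ln_ge0// lerDl divr_ge0// ltW.
  - by apply: emeasurable_funD; exact: measurable_funTS.
  - move=> z _; rewrite /L /log_kernel/= -EFinD lee_fin.
    exact: ln1D_dist_triangle.
rewrite ge0_integralD; last 5 first.
- exact: mB.
- by move=> z _.
- exact: measurable_funTS.
- by move=> z _.
- exact: measurable_funTS.
by apply: leeD; exact: step.
Qed.

(** The pointwise condition is the exponential of [log_diff_le_log_maximal]; finiteness of the norm
    supplies membership in L^p. *)
Lemma admissible_log_maximal (s p : R) f : (1 < p)%R ->
  measurable_fun [set: Rd R d] (f : Rd R d -> R) ->
  'N[mu]_p%:E[log_maximal s f] < +oo ->
  let g x := (2 ^+ d)%:E * log_maximal s f x in
  admissible s p f g /\ 'N[mu]_p%:E[g] <= (2 ^+ d)%:E * 'N[mu]_p%:E[log_maximal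
    s f].
Proof.
move=> p1 mf fin g; have p0 : (0 < p)%R by rewrite (lt_trans ltr01).
have c0 : (0 <= 2 ^+ d :> R)%R by exact: exprn_ge0.
have F0 x : 0 <= log_maximal s f x by exact: log_maximal_ge0.
have mF : measurable_fun [set: Rd R d] (log_maximal s f : Rd R d -> \bar R).
  exact: measurable_log_maximal.
have g0 x : 0 <= g x by rewrite mule_ge0.
have gp x : g x `^ p = ((2 ^+ d) `^ p)%:E * log_maximal s f x `^ p.
  by rewrite /g poweRM// poweR_EFin.
have Ng : 'N[mu]_p%:E[g] <= (2 ^+ d)%:E * 'N[mu]_p%:E[log_maximal s f].
  have := @Lnorm_le_of_integral ((2 ^+ d) `^ p) p g (log_maximal s f) p0
    (powR_ge0 _ _) g0 F0.
  rewrite -powRrM divff ?gt_eqF// powRr1//; apply.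
  rewrite -ge0_integralZl_EFin ?powR_ge0//; last 2 first.
  - by move=> x _; exact: poweR_ge0.
  - exact: (measurableT_comp (measurable_poweR p)).
  by rewrite (eq_integral _ _ (fun (x : Rd R d) _ => gp x)).
split=> //; split => //.
  split; first by apply: measurable_funeM.
  by apply: le_lt_trans Ng _; rewrite lte_mul_pinfty// fin_numE.
move=> x y xy; have := log_diff_le_log_maximal s mf xy; rewrite -/(g x) -/(g y).
set r := euclid_norm (x - y).
have r0 : (0 < r)%R by rewrite lt0r euclid_norm_eq0 subr_eq0 xy euclid_norm_ge0.
have rs0 : (0 < r `^ s)%R by exact: powR_gt0.
case: (g x + g y) => [G| |]//; last by rewrite gt0_muley ?leey.
rewrite -EFinB -EFinM !lee_fin => LG.
rewrite -ler_pdivrMl// mulrC lerBrDl.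
rewrite -[leLHS]lnK ?ler_expR// posrE ltr_pwDl// divr_ge0 ?(ltW rs0)//.
Qed.

End equivalence.

Theorem proposition3p2 (R : realType) (d : nat) (p : R)
    (hd : (1 <= d)%N) (hp : 1 < p) :
  (forall (s : R) (f : 'rV[R]_d -> R), 0 < s -> s <= 1 -> in_Lp_loc p f ->
     in_N s p f <-> in_Lp p (log_maximal s f)) /\
  (exists c C : R, [/\ 0 < c, c <= C &
     forall (s : R) (f : 'rV[R]_d -> R), 0 < s -> s <= 1 -> in_Lp_loc p f ->
       (c%:E * 'N[@lebesgue R d]_p%:E[log_maximal s f] <= N_seminorm s p f)%E /\
       (N_seminorm s p f <= C%:E * 'N[@lebesgue R d]_p%:E[log_maximal s f])%E]).
Proof.
split=> [s f s0 _ floc|].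
  have mf := floc.1; split=> [[_ [g adm]]|[_ Nf]]; last first.
    by split => //; eexists; exact: (admissible_log_maximal hp mf Nf).1.
  split; first exact: measurable_log_maximal.
  have [g0 [mg Ng] _] := adm.
  apply: le_lt_trans (log_maximal_Lnorm_le s0 hp mf adm) _.
  by rewrite lte_mul_pinfty ?lee_fin ?powR_ge0.
(* Adding 1 makes the constant visibly positive, hence invertible; it depends on [d] and [p]
   only. *)
pose M := admissible_constant d p + 1.
have M0 : 0 < M by rewrite ltr_wpDl// powR_ge0.
(* The upper bound itself needs [2 ^+ d]; the maximum secures [c <= C]. *)
exists M^-1, (Num.max M^-1 (2 ^+ d)); split;
  [by rewrite invr_gt0|by rewrite le_max lexx|].
move=> s f s0 _ [mf _]; split.
  apply: le_ereal_inf_tmp => _ [g adm <-].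
  rewrite lee_pdivrMl//; apply: le_trans (log_maximal_Lnorm_le s0 hp mf adm) _.
  by apply: lee_wpmul2r; rewrite ?Lnorm_ge0// lee_fin lerDl.
have C0 : 0 < Num.max M^-1 (2 ^+ d) by rewrite lt_max invr_gt0 M0.
(* With an infinite norm the right-hand side is infinite because the constant is positive. *)
have [Nf|] := ltP ('N[@lebesgue R d]_p%:E[log_maximal s f])%E +oo%E; last first.
  by rewrite leye_eq => /eqP ->; rewrite gt0_muley ?leey.
have [adm Ng] := admissible_log_maximal hp mf Nf.
apply: le_trans (le_trans Ng _).
  by apply: ereal_inf_lbound; eexists; first exact: adm.
by apply: lee_wpmul2r; rewrite ?Lnorm_ge0// lee_fin le_max lexx orbT.
Qed.
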